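(* Let $F$ be a field of characteristic $0$, let $\alpha\in F$ with $\alpha\notin\{-1,0,1/2,1,2\}$, and let $E$ be a vector space over $F$ of dimension $n\geq2$ endowed with a nondegenerate symmetric bilinear form $\langle\cdot,\cdot\rangle$. Then every polynomial identity of degree no more than $5$ satisfied by the algebra $S(\alpha,E)$ is a consequence of commutativity and the identity $$((a,b,c),d,b)+((c,b,d),a,b)+((d,b,a),c,b)=0,$$ where $(x,y,z)=(xy)z-x(yz)$.
   Context: $S(\alpha,E)=Fz_1\oplus Fz_2\oplus E$ is the commutative (nonassociative) algebra with bilinear product determined by $z_1^2=z_1$, $z_2^2=z_2$, $z_1z_2=0$, $ez_1=\alpha e$, $ez_2=(1-\alpha)e$, $ef=-\langle e,f\rangle(\alpha(\alpha-2)z_1+(\alpha^2-1)z_2)$ for $e,f\in E$. A polynomial identity of an algebra $A$ is an element $f$ of the free nonassociative $F$-algebra on countably many generators which vanishes under all substitutions of elements of $A$ for the generators. It is a consequence of a set of identities if it belongs to the $T$-ideal (the smallest ideal invariant under all endomorphisms of the free nonassociative algebra) generated by them. Commutativity is the identity $xy-yx=0$. *)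

(* Defs.v *)
From HB Require Import structures.
From mathcomp Require Import all_boot all_algebra.
From mathcomp Require Import finmap sesquilinear.
From mathcomp.multinomials Require Import monalg.

Set Implicit Arguments.
Unset Strict Implicit.
Unset Printing Implicit Defensive.

Import GRing.Theory.
Local Open Scope ring_scope.

(* The free magma on the generators x_0, x_1, ...: nonempty binary trees, so
   the free algebra below has no unit. *)
Inductive magma : Type :=
  | Gen of nat
  | Prod of magma & magma.

Fixpoint magma_enc (t : magma) : GenTree.tree nat :=
  match t with
  | Gen i => GenTree.Leaf i
  | Prod u v => GenTree.Node 0 [:: magma_enc u; magma_enc v]
  end.

Fixpoint magma_dec (t : GenTree.tree nat) : option magma :=
  match t with
  | GenTree.Leaf i => Some (Gen i)
  | GenTree.Node _ [:: t1; t2] =>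
      if (magma_dec t1, magma_dec t2) is (Some u, Some v)
      then Some (Prod u v) else None
  | _ => None
  end.

Lemma magma_encK : pcancel magma_enc magma_dec.
Proof. by elim=> //= u -> v ->. Qed.

HB.instance Definition _ := Choice.copy magma (pcan_type magma_encK).

Fixpoint magma_size (t : magma) : nat :=
  match t with
  | Gen _ => 1
  | Prod u v => (magma_size u + magma_size v)%N
  end.

Fixpoint magma_eval (A : Type) (mul : A -> A -> A) (s : nat -> A) (t : magma)
    : A :=
  match t with
  | Gen i => s i
  | Prod u v => mul (magma_eval mul s u) (magma_eval mul s v)
  end.

(* The free nonassociative F-algebra on countably many generators: finitely
   supported F-linear combinations of elements of the free magma. *)
Definition free_alg (F : fieldType) : lmodType F := {malg F[magma]}.

Section FreeAlgebra.
Variable F : fieldType.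
Implicit Types f g : free_alg F.

Definition gen (i : nat) : free_alg F := << Gen i >>.

Definition fmul f g : free_alg F :=
  \sum_(u <- msupp f) \sum_(v <- msupp g) << f@_u * g@_v *g Prod u v >>.

(* With this convention the zero element has degree 0. *)
Definition fdegree f : nat := (\max_(u <- msupp f) magma_size u)%N.

Definition feval (A : lmodType F) (mul : A -> A -> A) (s : nat -> A) f : A :=
  \sum_(u <- msupp f) f@_u *: magma_eval mul s u.

Definition is_identity (A : lmodType F) (mul : A -> A -> A) f : Prop :=
  forall s : nat -> A, feval mul s f = 0.

Definition is_ideal (I : free_alg F -> Prop) : Prop :=
  [/\ I 0,
      forall f g, I f -> I g -> I (f + g),
      forall (c : F) f, I f -> I (c *: f)
    & forall f g, I f -> I (fmul f g) /\ I (fmul g f)].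

Definition is_endomorphism (phi : free_alg F -> free_alg F) : Prop :=
  linear phi /\ {morph phi : f g / fmul f g}.

Definition is_Tideal (I : free_alg F -> Prop) : Prop :=
  is_ideal I /\
  forall phi, is_endomorphism phi -> forall f, I f -> I (phi f).

(* Membership in the T-ideal generated by G, i.e. in the intersection of all
   T-ideals containing G. *)
Definition is_consequence (G : free_alg F -> Prop) f : Prop :=
  forall I, is_Tideal I -> (forall g, G g -> I g) -> I f.

Definition fassoc f g h : free_alg F :=
  fmul (fmul f g) h - fmul f (fmul g h).

Definition commutativity : free_alg F :=
  fmul (gen 0) (gen 1) - fmul (gen 1) (gen 0).

Definition degree5_identity : free_alg F :=
  let a := gen 0 in let b := gen 1 in let c := gen 2 in let d := gen 3 in
  fassoc (fassoc a b c) d b + fassoc (fassoc c b d) a b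
  + fassoc (fassoc d b a) c b.

End FreeAlgebra.

Section SAlgebra.
Variables (F : fieldType) (E : vectType F).

(* (x1, x2, e) stands for x1 z_1 + x2 z_2 + e. *)
Definition Salg : lmodType F := (F^o * F^o * E)%type.

Definition Smul (alpha : F) (bil : {symmetric E}) (x y : Salg) : Salg :=
  let: (x1, x2, e) := x in
  let: (y1, y2, f) := y in
  (x1 * y1 - bil e f * (alpha * (alpha - 2)),
   x2 * y2 - bil e f * (alpha ^+ 2 - 1),
   (x1 * alpha + x2 * (1 - alpha)) *: f + (y1 * alpha + y2 * (1 - alpha)) *: e).

End SAlgebra.

(* Main.v *)
(** Write 1 = z1 + z2, m = (1 - alpha)^2 z1 + alpha^2 z2 and
    d = alpha (1 - alpha).  Then S(alpha, E) is unital, m^2 = (1 - 2 d) m - d^2,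
    m e = d e and e f = <e, f> (1 - m), so multilinear evaluations on 1, m and
    two orthogonal anisotropic vectors e, f are polynomials in d, and the
    excluded alpha are the zeros of d (d + 2) (1 - 4 d).

    In characteristic 0 polarization reduces the statement to multilinear
    identities.  Modulo commutativity the multilinear monomials of degree 5 span
    a space of dimension 105, in which the linearizations of the identity of
    degree 5 span a subspace of dimension 10.  The evaluations have rank 95: an
    explicit left inverse over Z[d], up to the factor 1080 d (d + 2) (1 - 4 d)^4,
    is checked by computation.  Permuting the variables, it is enough to give it
    on one monomial for each of the three shapes of monomials. *)

From HB Require Import structures.
From Stdlib Require Import BinInt.
Require Import Defs.
From mathcomp Require Import all_boot all_algebra.
From mathcomp Require Import finmap sesquilinear.
From mathcomp Require Import ring zify ssrZ.
From mathcomp.multinomials Require Import monalg.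
Import GRing.Theory.
Local Open Scope ring_scope.
Set Implicit Arguments.
Unset Strict Implicit.
Unset Printing Implicit Defensive.

(** * Linear maps out of the free algebra *)

(** [F] is an arbitrary field of characteristic 0, so <e, e> and <f, f> cannot be normalised to 1.
    In a multilinear evaluation every monomial receives the same letters, hence the same powers of
    these two scalars, which cancel; what is left is the value at d of polynomials over Z, and one
    check over Z[d] serves all fields and all alpha.

    In degree 5 the evaluations have a kernel, so a left inverse recovers monomials only up to the
    linearized identities: it recovers [nform]. There B is the pair of variables replacing the
    repeated b, and phi_B lives on left-normed monomials: (((xy)z)u)v meets only the pairs {x,v},
    {y,v}, {x,z}, {y,z}. A linearized identity contains 12 left-normed monomials, with coefficients
    1 or -1; each contributes 1 to the functional of its own pair, and the contributions to the
    other functionals cancel. Hence the factor 12.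

    For a multilinear identity P, 12 P is congruent to its image under [nform], and each coefficient
    of the image is, up to the denominator, a combination of evaluations of P, hence zero. *)

Section LinearExtension.
Variables (F : fieldType) (V : lmodType F).
Implicit Types (f g : free_alg F) (phi : magma -> V).

Definition lext phi f : V := \sum_(u <- msupp f) f@_u *: phi u.

(** Summing over a larger support adds only zero terms; elements with different supports can then be
    compared term by term, as linearity requires. *)
Lemma lextEw phi f (d : {fset magma}) :
  fsubset (msupp f) d -> lext phi f = \sum_(u <- d) f@_u *: phi u.
Proof.
move=> sfd; rewrite /lext (big_fset_incl _ sfd) // => u _.
by rewrite -mcoeff_eq0 => /eqP->; rewrite scale0r.
Qed.

Lemma lext_is_linear phi : linear (lext phi).
Proof.
move=> c f g.
pose d := fsetU (msupp (c *: f + g)) (fsetU (msupp f) (msupp g)).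
rewrite !(@lextEw _ _ d) ?fsubsetUl //.
- rewrite scaler_sumr -big_split; apply: eq_bigr => u _ /=.
  by rewrite mcoeffD mcoeffZ scalerDl scalerA.
- by rewrite /d fsubsetU // fsubsetUr orbT.
- by rewrite /d fsubsetU // fsubsetUl orbT.
Qed.

HB.instance Definition _ phi :=
  GRing.isLinear.Build F (free_alg F) V *:%R (lext phi) (lext_is_linear phi).

Lemma lextU phi t : lext phi << t >> = phi t.
Proof. by rewrite /lext msuppU oner_eq0 big_seq_fset1 mcoeffUU scale1r. Qed.

End LinearExtension.

Section FreeAlgebra.
Variable F : fieldType.
Implicit Types (f g h : free_alg F) (t u v : magma).

Definition mon t : free_alg F := << t >>.

Lemma free_algE f : f = \sum_(t <- msupp f) f@_t *: mon t.
Proof.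
rewrite {1}[f]monalgE; apply: eq_bigr => t _; apply/malgP => u.
by rewrite mcoeffZ !mcoeffU mulr_natr.
Qed.

(** Seen as an iterated linear extension, the product inherits bilinearity from [lext]. *)
Lemma fmulE f g :
  fmul f g = lext (fun u => lext (fun v => mon (Prod u v)) g) f.
Proof.
apply: eq_bigr => u _; rewrite /lext scaler_sumr; apply: eq_bigr => v _.
by rewrite scalerA; apply/malgP => w; rewrite mcoeffZ !mcoeffU mulr_natr.
Qed.

Lemma fmulUU u v : fmul (mon u) (mon v) = mon (Prod u v).
Proof. by rewrite fmulE !lextU. Qed.

Lemma fmulDl : left_distributive (@fmul F) +%R.
Proof. by move=> f g h; rewrite !fmulE linearD. Qed.

Lemma fmulZl c f g : fmul (c *: f) g = c *: fmul f g.
Proof. by rewrite !fmulE linearZ. Qed.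

Lemma lext_pw (V : lmodType F) (p q : magma -> V) (c : F) f :
  lext (fun u => c *: p u + q u) f = c *: lext p f + lext q f.
Proof.
rewrite /lext scaler_sumr -big_split; apply: eq_bigr => u _ /=.
by rewrite scalerDr !scalerA mulrC.
Qed.

Lemma fmul_linearr f c g h : fmul f (c *: g + h) = c *: fmul f g + fmul f h.
Proof.
rewrite !fmulE -lext_pw; apply: eq_bigr => u _; congr (_ *: _).
by rewrite linearP.
Qed.

Lemma fmul0l g : fmul 0 g = 0.
Proof. by rewrite fmulE linear0. Qed.

Lemma fmulDr : right_distributive (@fmul F) +%R.
Proof. by move=> f g h; have := fmul_linearr f 1 g h; rewrite !scale1r. Qed.

Lemma fmul0r f : fmul f 0 = 0.
Proof. by have := fmulDr f 0 0; rewrite addr0 => /esym/eqP; rewrite -subr_eq0 addrK => /eqP. Qed.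

Lemma fmulZr c f g : fmul f (c *: g) = c *: fmul f g.
Proof. by have := fmul_linearr f c g 0; rewrite !addr0 fmul0r addr0. Qed.

Definition fsubst (s : nat -> free_alg F) : free_alg F -> free_alg F :=
  lext (magma_eval (@fmul F) s).

HB.instance Definition _ s :=
  GRing.Linear.copy (fsubst s) (lext (magma_eval (@fmul F) s)).

Lemma fsubst_gen s i : fsubst s (gen F i) = s i.
Proof. exact: lextU. Qed.

Lemma fmull_is_linear g : linear (fun f => fmul f g).
Proof. by move=> c f h; rewrite fmulDl fmulZl. Qed.

Lemma fmulr_is_linear f : linear (fmul f).
Proof. by move=> c g h; rewrite fmulDr fmulZr. Qed.

HB.instance Definition _ f := GRing.isLinear.Build F (free_alg F) (free_alg F)
  *:%R (fmul f) (fmulr_is_linear f).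

Lemma fmulBr f g h : fmul f (g - h) = fmul f g - fmul f h.
Proof. exact: (linearB (fmul f)). Qed.

Lemma fmulBl f g h : fmul (f - g) h = fmul f h - fmul g h.
Proof. by rewrite fmulDl -scaleN1r fmulZl scaleN1r. Qed.

Lemma linear_comp_lext (V W : lmodType F) (h : V -> W) (p : magma -> V) f :
  linear h -> h (lext p f) = lext (h \o p) f.
Proof.
move=> lin_h; pose H := GRing.isLinear.Build F V W *:%R h lin_h.
pose h' : {linear V -> W} := HB.pack h H.
rewrite -[h]/(h' : V -> W) linear_sum; apply: eq_bigr => u _.
by rewrite linearZ.
Qed.

Lemma eq_lext (V : lmodType F) (p q : magma -> V) f :
  p =1 q -> lext p f = lext q f.
Proof. by move=> eq_pq; apply: eq_bigr => u _; rewrite eq_pq. Qed.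

(** Both sides are iterated linear extensions, so it is enough to compare them on monomials, where
    [magma_eval] is multiplicative by definition. *)
Lemma fsubstM s : {morph fsubst s : f g / fmul f g}.
Proof.
move=> f g; rewrite {1}fmulE linear_comp_lext; last exact: linearP.
rewrite [RHS](linear_comp_lext _ _ (fmull_is_linear (fsubst s g))).
apply: eq_lext => u /=.
rewrite linear_comp_lext; last exact: linearP.
rewrite linear_comp_lext; last exact: linearP.
by apply: eq_lext => v; exact: lextU.
Qed.

Lemma fsubst_endo s : is_endomorphism (fsubst s).
Proof. by split; [exact: linearP | exact: fsubstM]. Qed.

End FreeAlgebra.

(** * Polarization *)

Fixpoint leaves (t : magma) : seq nat :=
  match t with Gen i => [:: i] | Prod u v => leaves u ++ leaves v end.

Fixpoint relabel (g : nat -> nat) (t : magma) : magma :=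
  match t with
  | Gen i => Gen (g i)
  | Prod u v => Prod (relabel g u) (relabel g v)
  end.

Definition positions (w : seq nat) (i : nat) : seq nat :=
  [seq j <- iota 0 (size w) | nth 0%N w j == i].

(* The monomials that become [t] under the substitution x_j -> x_(w_j). *)
Fixpoint preimages (w : seq nat) (t : magma) : seq magma :=
  match t with
  | Gen i => [seq Gen j | j <- positions w i]
  | Prod u v => [seq Prod u' v' | u' <- preimages w u, v' <- preimages w v]
  end.

(** The counterpart of [preimages] on leaf words: the number of bijective preimages of a monomial
    can be counted without its bracketing. *)
Fixpoint word_preimages (w l : seq nat) : seq (seq nat) :=
  if l is i :: l' then
    [seq j :: p | j <- positions w i, p <- word_preimages w l']
  else [:: [::]].

Lemma size_leaves t : size (leaves t) = magma_size t.
Proof. by elim: t => //= u <- v <-; rewrite size_cat. Qed.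

Lemma leaves_relabel g t : leaves (relabel g t) = map g (leaves t).
Proof. by elim: t => //= u -> v ->; rewrite map_cat. Qed.

Lemma preimagesP w t u : u \in preimages w t ->
  relabel (nth 0%N w) u = t /\ all (fun j => j < size w)%N (leaves u).
Proof.
elim: t u => [i|t1 IH1 t2 IH2] u /=.
  case/mapP=> j; rewrite mem_filter mem_iota /= add0n => /andP[/eqP wj lt_jw] ->.
  by rewrite /= wj lt_jw.
case/allpairsP=> [[u1 u2] /= [/IH1[r1 a1] /IH2[r2 a2] ->]] /=.
by rewrite r1 r2 all_cat a1 a2.
Qed.

Lemma word_preimages_cat w l1 l2 :
  word_preimages w (l1 ++ l2) =
  [seq p1 ++ p2 | p1 <- word_preimages w l1, p2 <- word_preimages w l2].
Proof.
elim: l1 => [|i l1 IHl] /=; first by rewrite cats0 map_id.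
rewrite IHl; elim: (positions w i) => //= j s ->.
rewrite allpairs_cat; congr (_ ++ _).
by rewrite allpairs_mapl map_allpairs.
Qed.

Lemma leaves_preimages w t :
  map leaves (preimages w t) = word_preimages w (leaves t).
Proof.
elim: t => [i|t1 IH1 t2 IH2] /=.
  by elim: (positions w i) => //= j s <-.
by rewrite word_preimages_cat -IH1 -IH2 map_allpairs allpairs_mapl allpairs_mapr.
Qed.

(* The number of permutations p of the positions with [w_(p_k) = l_k]. *)
Definition nb_bij (w l : seq nat) : nat :=
  count (fun p => perm_eq p (iota 0 (size w))) (word_preimages w l).

(** Exchanging two adjacent blocks of the word exchanges two summations, and block exchanges
    generate all permutations. All monomials of one multidegree therefore get the same multiplicity
    when a linearization is specialised back. *)
Lemma nb_bij_perm w l1 l2 : perm_eq l1 l2 -> nb_bij w l1 = nb_bij w l2.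
Proof.
have countE (T : Type) (a : pred T) s : count a s = (\sum_(p <- s) a p)%N.
  by elim: s => [|x s IHs]; rewrite ?big_nil ?big_cons //= IHs.
have catCA s1 s2 s3 : nb_bij w (s1 ++ s2 ++ s3) = nb_bij w (s2 ++ s1 ++ s3).
  rewrite /nb_bij !countE !word_preimages_cat !big_allpairs_dep /=.
  under eq_bigr => p1 _ do rewrite big_allpairs_dep.
  under [RHS]eq_bigr => p2 _ do rewrite big_allpairs_dep.
  rewrite exchange_big; apply: eq_bigr => p2 _.
  by apply: eq_bigr => p1 _; apply: eq_bigr => p3 _; rewrite perm_catCA.
move=> eq_l; pose P s := nb_bij w l1 = nb_bij w s.
by apply: (catCA_perm_ind (P := P)) eq_l _ => // s1 s2 s3; rewrite /P catCA.
Qed.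

(** The identity permutation is counted. This is the multiplicity to be divided out after
    polarization; for the induction, the claim is generalised to the suffixes of [w]. *)
Lemma nb_bij_gt0 w : (0 < nb_bij w w)%N.
Proof.
rewrite -has_count; apply/hasP; exists (iota 0 (size w)) => //.
suff H k l : l = drop k w -> iota k (size l) \in word_preimages w l.
  by apply: H; rewrite drop0.
elim: l k => [|i l IHl] k Dl //=.
have lt_kw : (k < size w)%N.
  by rewrite ltnNge; apply/negP => le_wk; rewrite drop_oversize in Dl.
move: Dl; rewrite (drop_nth 0%N) // => -[Di Dl].
apply/allpairsP; exists (k, iota k.+1 (size l)); split=> //=; last exact: IHl.
by rewrite mem_filter mem_iota /= add0n lt_kw Di eqxx.
Qed.

Section Multilinear.
Variables (F : fieldType) (A : lmodType F) (mul : A -> A -> A).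
Hypothesis mul_linl : forall y, linear (mul^~ y).
Hypothesis mul_linr : forall x, linear (mul x).

Let mulDl x y z : mul (x + y) z = mul x z + mul y z.
Proof. by have := mul_linl z 1 x y; rewrite !scale1r. Qed.
Let mul0l x : mul 0 x = 0.
Proof. by apply: (addIr (mul 0 x)); rewrite -mulDl !add0r. Qed.
Let mulZl c x y : mul (c *: x) y = c *: mul x y.
Proof. by have := mul_linl y c x 0; rewrite !addr0 mul0l addr0. Qed.
Let mulDr x y z : mul x (y + z) = mul x y + mul x z.
Proof. by have := mul_linr x 1 y z; rewrite !scale1r. Qed.
Let mul0r x : mul x 0 = 0.
Proof. by apply: (addIr (mul x 0)); rewrite -mulDr !add0r. Qed.
Let mulZr c x y : mul x (c *: y) = c *: mul x y.
Proof. by have := mul_linr x c y 0; rewrite !addr0 mul0r addr0. Qed.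

Lemma eval_scale (c : F) s t :
  magma_eval mul (fun i => c *: s i) t
  = c ^+ magma_size t *: magma_eval mul s t.
Proof.
elim: t => [i|u IHu v IHv]; first by rewrite expr1.
rewrite [LHS]/= IHu IHv /=.
by rewrite mulZl mulZr scalerA exprD.
Qed.

(** Distributivity: expanding the product chooses, for each leaf labelled i, one position of i in
    [w], and such choices are the preimages of [t]. *)
Lemma eval_preimages (w : seq nat) (x : nat -> F) (b : nat -> A) t :
  magma_eval mul (fun i => \sum_(j <- positions w i) x j *: b j) t
  = \sum_(u <- preimages w t) (\prod_(j <- leaves u) x j) *: magma_eval mul b u.
Proof.
elim: t => [i|t1 IH1 t2 IH2] /=.
  rewrite big_map; apply: eq_bigr => j _ /=; by rewrite big_seq1.
rewrite big_allpairs_dep IH1 IH2.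
elim: (preimages w t1) => [|u1 s1 IHs]; first by rewrite !big_nil mul0l.
rewrite !big_cons mulDl IHs; congr (_ + _).
elim: (preimages w t2) => [|u2 s2 IHs2]; first by rewrite !big_nil mul0r.
by rewrite !big_cons mulDr IHs2 mulZl mulZr scalerA big_cat.
Qed.

End Multilinear.

Section CharZero.
Variable F : fieldType.
Hypothesis charF0 : [pchar F] =i pred0.

Lemma natr_eq0F n : (n%:R == 0 :> F) = (n == 0)%N.
Proof. by move/pcharf0P: charF0 => ->. Qed.

(* Replacing m by 2 m multiplies the d-th term by 2 ^ d, so a combination of
   the two relations eliminates the top term. *)
Lemma power_sum_eq0 (V : lmodType F) N (v : nat -> V) :
  (forall m, \sum_(d < N) (m ^ d)%:R *: v d = 0) ->
  forall d, (d < N)%N -> v d = 0.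
Proof.
elim: N v => // N IHN v v0.
have vlt d : (d < N)%N -> v d = 0.
  move=> ltdN; pose v' d := ((2 ^ d)%:R - (2 ^ N)%:R : F) *: v d.
  have /IHN/(_ d ltdN)/eqP : forall m, \sum_(d < N) (m ^ d)%:R *: v' d = 0.
    move=> m; have := congr1 ( *:%R (2 ^ N)%:R) (v0 m).
    have := v0 (m * 2)%N; rewrite !big_ord_recr /= scaler0 => e1.
    rewrite scalerDr => e2.
    have := congr2 (fun x y => x - y) e1 e2; rewrite /= subr0.
    rewrite expnMn natrM scalerA [_%:R * _%:R]mulrC opprD addrACA subrr addr0 => e3.
    rewrite -[RHS]e3 scaler_sumr -sumrB; apply: eq_bigr => i _.
    by rewrite /v' !scalerA -scalerBl expnMn natrM mulrBr [(2 ^ N)%:R * _]mulrC.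
  rewrite scaler_eq0 => /orP[|/eqP //]; rewrite subr_eq0.
  wlog: / (2 ^ d <= 2 ^ N)%N by apply; rewrite leq_exp2l // ltnW.
  move=> le_dN; rewrite eq_sym -subr_eq0 -natrB // natr_eq0F subn_eq0.
  by rewrite leq_exp2l // leqNgt ltdN.
move=> d; rewrite ltnS leq_eqVlt => /orP[/eqP->|/vlt //].
have := v0 1%N; rewrite big_ord_recr /= big1 ?add0r; last first.
  by move=> i _; rewrite vlt ?scaler0.
by rewrite exp1n scale1r.
Qed.

End CharZero.

Section Polarization.
Variable F : fieldType.
Hypothesis charF0 : [pchar F] =i pred0.
Variables (A : lmodType F) (mul : A -> A -> A).
Hypothesis mul_linl : forall y, linear (mul^~ y).
Hypothesis mul_linr : forall x, linear (mul x).
Variables (f : free_alg F).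
Hypothesis f_id : is_identity mul f.

(** Scaling all variables by m multiplies the component of degree d by m ^ d, so vanishing for all
    natural m separates the components. *)
Lemma homogeneous_identity n s :
  \sum_(t <- msupp f | magma_size t == n) f@_t *: magma_eval mul s t = 0.
Proof.
(* The maximum with [n] covers degrees beyond that of [f], where the component is empty; the
   successor makes the range d < N include both bounds. *)
pose N := (maxn n (fdegree f)).+1.
pose v d := \sum_(t <- msupp f | magma_size t == d) f@_t *: magma_eval mul s t.
apply: (power_sum_eq0 charF0 (N := N) (v := v)); last by rewrite /N ltnS leq_maxl.
move=> m; have := f_id (fun i => m%:R *: s i); rewrite /feval => f0.
rewrite -[RHS]f0 /v.
under eq_bigr do rewrite scaler_sumr big_mkcond.
rewrite exchange_big !big_seq; apply: eq_bigr => t tf.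
have lttN : (magma_size t < N)%N.
  rewrite /N ltnS leq_max; apply/orP; right.
  exact: (leq_bigmax_seq (F := magma_size) t tf).
rewrite (bigD1 (Ordinal lttN)) //= eqxx big1 ?addr0; last first.
  by move=> d; rewrite -val_eqE /= eq_sym => /negbTE->.
by rewrite eval_scale // !scalerA natrX mulrC.
Qed.

Definition ord_mem n (S : {set 'I_n}) : pred nat :=
  fun j => if insub j is Some i then i \in S else false.

(* Inclusion-exclusion: only the words in which every letter occurs survive. *)
Lemma alternating_sum n (l : seq nat) :
  size l = n -> all (fun j => j < n)%N l ->
  \sum_(S : {set 'I_n}) (-1) ^+ #|S| * (all (ord_mem S) l)%:R
  = (-1) ^+ n * (perm_eq l (iota 0 n))%:R :> F.
Proof.
move=> sz_l ltl; have [pl|npl] := boolP (perm_eq l (iota 0 n)).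
  have allS (S : {set 'I_n}) : all (ord_mem S) l = (S == setT).
    rewrite (perm_all _ pl); apply/allP/eqP => [memS|-> j].
      apply/setP => i; rewrite in_setT.
      have := memS i; rewrite mem_iota ltn_ord => /(_ isT).
      by rewrite /ord_mem valK.
    by rewrite mem_iota /ord_mem => /andP[_ ltj]; rewrite insubT in_setT.
  rewrite (bigD1 setT) //= allS eqxx cardsT card_ord big1 ?addr0 //.
  by move=> S /negbTE nS; rewrite allS nS mulr0.
(* A word of length n that contains all n letters would be a permutation of them. *)
have [j nlj] : exists j : 'I_n, val j \notin l.
  apply/existsP; apply: contraR npl; rewrite negb_exists => /forallP lP.
  rewrite perm_sym; apply/uniq_perm; rewrite ?iota_uniq //.
    apply: (@leq_size_uniq _ (iota 0 n)); rewrite ?iota_uniq ?size_iota ?sz_l //.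
    move=> k; rewrite mem_iota => /andP[_ ltk].
    by have := lP (Ordinal ltk); rewrite negbK.
  move=> k; apply/idP/idP; rewrite mem_iota => /=.
    by move=> ltk; have := lP (Ordinal ltk); rewrite negbK.
  by move/(allP ltl).
(* Adding or removing a letter missing from [l] changes the sign of a term and nothing else, so the
   sum equals its opposite. *)
pose flip (S : {set 'I_n}) := if j \in S then S :\ j else j |: S.
have flipK : involutive flip.
  move=> S; rewrite /flip; have [jS|njS] := boolP (j \in S).
    by rewrite setD11 setD1K.
  by rewrite setU11 setU1K.
set X := (LHS).
have XN : X = - X.
  rewrite {1}/X (reindex_inj (inv_inj flipK)) -sumrN; apply: eq_bigr => S _.
  rewrite -mulNr; congr (_ * _%:R).
    rewrite /flip; have [jS|njS] := boolP (j \in S).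
      by rewrite [#|S|](cardsD1 j) jS exprS mulN1r opprK.
    by rewrite cardsU1 njS exprS mulN1r.
  congr nat_of_bool; apply: eq_in_all => k kl; rewrite /ord_mem.
  case: insubP => // i _ Di; rewrite /flip.
  have nij : i != j by apply: contraNneq nlj => <-; rewrite Di.
  by case: ifP => _; rewrite !inE (negbTE nij).
rewrite (_ : _%:R = 0) ?mulr0 //.
have /eqP : X *+ 2 = 0 by rewrite mulr2n {2}XN subrr.
by rewrite -mulr_natl mulf_eq0 natr_eq0F // => /eqP.
Qed.

(** For each set S of positions, x_i is replaced by the sum of the b_j over the positions j in S
    that carry i. The alternating sum over S keeps the preimages that use every position once, which
    gives the full linearization in multidegree [w]. *)
Lemma polarized_identity (w : seq nat) (b : nat -> A) :
  let n := size w in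
  \sum_(t <- msupp f | magma_size t == n)
     \sum_(u <- preimages w t | perm_eq (leaves u) (iota 0 n))
        f@_t *: magma_eval mul b u = 0.
Proof.
move=> n; apply: (can_inj (scalerK (a := (-1) ^+ n : F) _)).
  by rewrite signr_eq0.
rewrite scaler0.
pose s (S : {set 'I_n}) i := \sum_(j <- positions w i) (ord_mem S j)%:R *: b j.
transitivity (\sum_(S : {set 'I_n}) (-1) ^+ #|S| *:
   (\sum_(t <- msupp f | magma_size t == n) f@_t *: magma_eval mul (s S) t));
  last by rewrite big1 // => S _; rewrite homogeneous_identity scaler0.
under [RHS]eq_bigr do rewrite scaler_sumr.
rewrite exchange_big scaler_sumr; apply: eq_bigr => t /eqP szt.
under [RHS]eq_bigr do rewrite /s eval_preimages // scalerA scaler_sumr.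
rewrite exchange_big scaler_sumr big_mkcond /=.
rewrite !big_seq; apply: eq_bigr => u ut.
have [rel_u lt_u] := preimagesP ut.
have szu : size (leaves u) = n.
  by rewrite -szt -rel_u -[RHS]size_leaves leaves_relabel size_map.
under eq_bigr do rewrite scalerA.
rewrite -scaler_suml.
have -> : \sum_(S : {set 'I_n}) (-1) ^+ #|S| * f@_t *
    (\prod_(j <- leaves u) (ord_mem S j)%:R) =
    f@_t * ((-1) ^+ n * (perm_eq (leaves u) (iota 0 n))%:R).
  rewrite -alternating_sum // mulr_sumr; apply: eq_bigr => S _.
  rewrite mulrCA mulrA; congr (_ * _).
  by elim: (leaves u) => [|j l IHl]; rewrite ?big_nil // big_cons IHl /= -natrM mulnb.
by case: ifP => _; rewrite ?mulr1 ?mulr0 ?scale0r // scalerA mulrC.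
Qed.

End Polarization.

(** * Reduction of identities of bounded degree to multilinear ones *)

Definition multilinear n t := perm_eq (leaves t) (iota 0 n).

Section Reduction.
Variable F : fieldType.
Hypothesis charF0 : [pchar F] =i pred0.
Variable I : free_alg F -> Prop.
Hypothesis I_Tideal : is_Tideal I.

Lemma Tideal0 : I 0.
Proof. by case: I_Tideal => -[]. Qed.

Lemma TidealD f g : I f -> I g -> I (f + g).
Proof. by case: I_Tideal => -[_ ID _ _] _; exact: ID. Qed.

Lemma TidealZ c f : I f -> I (c *: f).
Proof. by case: I_Tideal => -[_ _ IZ _] _; exact: IZ. Qed.

Lemma TidealN f : I f -> I (- f).
Proof. by move=> If; rewrite -scaleN1r; exact: TidealZ. Qed.

Lemma TidealB f g : I f -> I g -> I (f - g).
Proof. by move=> If Ig; apply: TidealD => //; exact: TidealN. Qed.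

Lemma TidealMr f g : I f -> I (fmul f g).
Proof. by case: I_Tideal => -[_ _ _ IM] _ /(IM _ g)[]. Qed.

Lemma TidealMl f g : I f -> I (fmul g f).
Proof. by case: I_Tideal => -[_ _ _ IM] _ /(IM _ g)[]. Qed.

Lemma Tideal_subst s f : I f -> I (fsubst s f).
Proof. by case: I_Tideal => _; apply; exact: fsubst_endo. Qed.

Lemma Tideal_sum (J : eqType) (r : seq J) (P : pred J) (g : J -> free_alg F) :
  (forall j, j \in r -> P j -> I (g j)) -> I (\sum_(j <- r | P j) g j).
Proof.
move=> Ig; rewrite big_seq_cond; elim/big_ind: _ => [||j /andP[]].
- exact: Tideal0.
- exact: TidealD.
- exact: Ig.
Qed.

Lemma fsubst_relabel g u :
  fsubst (fun i => gen F (g i)) (mon F u) = mon F (relabel g u).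
Proof.
rewrite [LHS]lextU; elim: u => //= u -> v ->.
exact: fmulUU.
Qed.

Variables (A : lmodType F) (mul : A -> A -> A).
Hypothesis mul_linl : forall y, linear (mul^~ y).
Hypothesis mul_linr : forall x, linear (mul x).
Variable N : nat.

Hypothesis multilinear_Tideal : forall n (P : seq (F * magma)),
  (0 < n <= N)%N -> all (multilinear n) (map snd P) ->
  (forall s, \sum_(p <- P) p.1 *: magma_eval mul s p.2 = 0) ->
  I (\sum_(p <- P) p.1 *: mon F p.2).

Lemma magma_size_gt0 t : (0 < magma_size t)%N.
Proof. by elim: t => //= u IHu v _; rewrite addn_gt0 IHu. Qed.

(** The components of [f] are indexed by sorted leaf words w. The linearization of a component is a
    multilinear identity, hence in I; substituting x_j -> x_(w_j) stays in I and returns the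
    component times [nb_bij w w], which is invertible. *)
Theorem Tideal_of_multilinear f :
  (fdegree f <= N)%N -> is_identity mul f -> I f.
Proof.
move=> deg_f f_id; pose key t := sort leq (leaves t).
pose ws := undup (map key (msupp f)).
have -> : f = \sum_(w <- ws) \sum_(t <- msupp f | key t == w) f@_t *: mon F t.
  rewrite [LHS]free_algE.
  under [RHS]eq_bigr do rewrite big_mkcond.
  rewrite exchange_big !big_seq; apply: eq_bigr => t tf /=.
  have kt : key t \in ws by rewrite mem_undup map_f.
  rewrite (bigD1_seq (key t)) ?undup_uniq //= eqxx big1 ?addr0 //.
  by move=> w; rewrite eq_sym => /negbTE->.
apply: Tideal_sum => w; rewrite mem_undup => /mapP[t0 t0f Dw] _.
pose n := size w.
have szkey t : size (key t) = magma_size t by rewrite size_sort size_leaves.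
have n_bnd : (0 < n <= N)%N.
  rewrite /n Dw szkey magma_size_gt0 /=; apply: leq_trans deg_f.
  exact: (leq_bigmax_seq (F := magma_size) t0 t0f).
pose P := [seq (f@_t, u) | t <- [seq t <- msupp f | magma_size t == n],
             u <- [seq u <- preimages w t | perm_eq (leaves u) (iota 0 n)]].
have sumP (V : lmodType F) (g : magma -> V) : \sum_(p <- P) p.1 *: g p.2 =
    \sum_(t <- msupp f | magma_size t == n)
      \sum_(u <- preimages w t | perm_eq (leaves u) (iota 0 n)) f@_t *: g u.
  rewrite big_allpairs_dep big_filter; apply: eq_bigr => t _.
  by rewrite big_filter.
have /(Tideal_subst (fun i => gen F (nth 0%N w i))) :
    I (\sum_(p <- P) p.1 *: mon F p.2).
  apply: multilinear_Tideal n_bnd _ _; last first.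
    by move=> s; rewrite sumP; exact: polarized_identity.
  apply/allP => u /mapP[p /allpairsPdep[t [u' [_ + ->]]] ->] /=.
  by rewrite mem_filter => /andP[].
rewrite sumP linear_sum.
have charw : (nb_bij w w)%:R != 0 :> F.
  by rewrite natr_eq0F // -lt0n nb_bij_gt0.
move=> Isum; rewrite -[X in I X](scalerK charw); apply: TidealZ.
move: Isum; congr I; rewrite scaler_sumr [RHS]big_mkcond [LHS]big_mkcond /=.
apply: eq_bigr => t _.
have nbE : \sum_(u <- preimages w t | perm_eq (leaves u) (iota 0 n)) 1 =
           (nb_bij w (leaves t))%:R :> F.
  rewrite /nb_bij -leaves_preimages count_map -sum1_count natr_sum.
  exact: eq_bigl.
have lhsE : fsubst (fun i => gen F (nth 0%N w i))
    (\sum_(u <- preimages w t | perm_eq (leaves u) (iota 0 n))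
        f@_t *: mon F u) = (nb_bij w (leaves t))%:R *: (f@_t *: mon F t).
  rewrite linear_sum -nbE scaler_suml big_seq_cond [RHS]big_seq_cond.
  apply: eq_bigr => u.
  move=> /andP[/preimagesP[rel_u _] _].
  by rewrite linearZ scale1r -[LHS]/(_ *: fsubst _ _) fsubst_relabel rel_u.
(* A bijective preimage of [t] forces its leaves to be a rearrangement of [w], so monomials of
   another multidegree have multiplicity 0. *)
rewrite lhsE; have [keyt|nkeyt] := eqVneq (key t) w; last first.
  case: ifP => // _; suff -> : nb_bij w (leaves t) = 0%N by rewrite scale0r.
  apply/eqP; rewrite /nb_bij -leaves_preimages count_map -leqn0 leqNgt -has_count.
  apply/hasPn => u /preimagesP[rel_u lt_u] /=; apply/negP => pu; case/eqP: nkeyt.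
  rewrite [RHS]Dw; apply/perm_sortP.
  - exact: leq_total.
  - exact: leq_trans.
  - exact: anti_leq.
  rewrite -rel_u leaves_relabel; apply: (perm_trans (perm_map _ pu)).
  by rewrite map_nth_iota0 // take_size Dw perm_sort.
rewrite -szkey keyt eqxx; congr (_%:R *: _).
by apply: nb_bij_perm; rewrite -keyt /key perm_sym perm_sort.
Qed.

End Reduction.

(** * The certificate *)

(** Equality in the free commutative magma. *)
Fixpoint eqc (t u : magma) : bool :=
  match t, u with
  | Gen i, Gen j => i == j
  | Prod t1 t2, Prod u1 u2 =>
      eqc t1 u1 && eqc t2 u2 || eqc t1 u2 && eqc t2 u1
  | _, _ => false
  end.

(** With the larger factor on the left, the shape of a commutative monomial of small degree can be
    read by pattern matching. Factors of equal size are not ordered, so this is not a normal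
    form. *)
Fixpoint orient (t : magma) : magma :=
  match t with
  | Gen i => Gen i
  | Prod u v =>
      if (magma_size v <= magma_size u)%N then Prod (orient u) (orient v)
      else Prod (orient v) (orient u)
  end.

Fixpoint oriented (t : magma) : bool :=
  match t with
  | Gen _ => true
  | Prod u v => [&& magma_size v <= magma_size u, oriented u & oriented v]%N
  end.

(** Here [n] is fuel, for which the length of [l] is enough; the cuts start at 1 and stop before the
    end, so that both factors are nonempty. *)
Fixpoint trees_of (n : nat) (l : seq nat) : seq magma :=
  match n, l with
  | 0, _ => [::]
  | _, [:: i] => [:: Gen i]
  | n'.+1, _ =>
      flatten [seq [seq Prod u v | u <- trees_of n' (take k l),
                                   v <- trees_of n' (drop k l)]
              | k <- iota 1 (size l).-1]
  end.

Definition oriented_trees (n : nat) (l : seq nat) : seq magma :=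
  [seq t <- trees_of n l | oriented t].

Definition add_rep (t : magma) (s : seq magma) : seq magma :=
  if has (eqc t) s then s else t :: s.

(** A transversal of the multilinear monomials modulo commutativity, made of oriented ones: the
    columns of the certificate. *)
Definition reps (n : nat) : seq magma :=
  foldr add_rep [::] (flatten [seq oriented_trees n l | l <- permutations (iota 0 n)]).

(** Polynomials in d by increasing degree, over binary integers to suit the virtual machine.
    Trailing zeros are allowed, so vanishing is tested on each coefficient. *)
Definition pol := seq Z.

Fixpoint padd (p q : pol) : pol :=
  match p, q with
  | [::], _ => q
  | _, [::] => p
  | a :: p', b :: q' => Z.add a b :: padd p' q'
  end.

Definition pscale (c : Z) (p : pol) : pol := map (Z.mul c) p.

Fixpoint pmul (p q : pol) : pol :=
  if p is a :: p' then padd (pscale a q) (Z0 :: pmul p' q) else [::].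

Section Graded.
Variables (R : Type) (zero one : R) (add mul : R -> R -> R).
Variables (d nd2 o2d m1 : R).

(* A value is a parity (number of e's, number of f's) with its coordinates on
   1 and m, on e alone, or on f alone; d, nd2, o2d, m1 stand for d, - d^2,
   1 - 2 d and -1. *)
Definition gmul (x y : (bool * bool) * (R * R)) : (bool * bool) * (R * R) :=
  let: ((i, j), (x0, x1)) := x in
  let: ((k, l), (y0, y1)) := y in
  ((i (+) k, j (+) l),
   match i, j, k, l with
   | false, false, false, false =>
       (add (mul x0 y0) (mul nd2 (mul x1 y1)),
        add (add (mul x0 y1) (mul x1 y0)) (mul o2d (mul x1 y1)))
   | false, false, true, true | true, true, false, false => (zero, zero)
   | false, false, _, _ => (mul (add x0 (mul d x1)) y0, zero)
   | _, _, false, false => (mul (add y0 (mul d y1)) x0, zero)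
   | true, false, true, false | false, true, false, true =>
       (mul x0 y0, mul m1 (mul x0 y0))
   | _, _, _, _ => (zero, zero)
   end).

Definition ggen (i : nat) : (bool * bool) * (R * R) :=
  match i with
  | 0 => ((false, false), (one, zero))
  | 1 => ((false, false), (zero, one))
  | 2 => ((true, false), (one, zero))
  | _ => ((false, true), (one, zero))
  end.

Definition gval (b : nat -> nat) (t : magma) : (bool * bool) * (R * R) :=
  magma_eval gmul (fun x => ggen (b x)) t.

Definition gcoord (k : bool) (x : (bool * bool) * (R * R)) : R :=
  if k then x.2.2 else x.2.1.

End Graded.

Local Open Scope Z_scope.

Definition pval : (nat -> nat) -> magma -> (bool * bool) * (pol * pol) :=
  gval [::] [:: 1] padd pmul [:: 0; 1] [:: 0; 0; (-1)] [:: 1; (-2)] [:: (-1)].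

Definition pgmul :=
  gmul [::] padd pmul [:: 0; 1] [:: 0; 0; (-1)] [:: 1; (-2)] [:: (-1)].

(* [(w, k, p)] stands for [p] times the coordinate [k] (that of m if [k], that
   of 1, e or f otherwise) of the value at the word [w]; letters 0, 1, 2, 3 of
   [w] mean 1, m, e, f, and are attached to the leaves from left to right.  The
   tables were found by linear algebra over Q(d), one isotypic component of
   the symmetric group at a time. *)
Definition row : Type := seq nat * bool * pol.

Definition rows1 : seq row := [::
([:: 0]%N, false, [:: 0; 25920; (-401760); 2280960; (-5391360); 3317760; 3317760])].

Definition rows2 : seq row := [::
([:: 0;0]%N, false, [:: 0; 12960; (-200880); 1140480; (-2695680); 1658880; 1658880])].

Definition rows3 : seq row := [::
([:: 0;2;0]%N, false, [:: 0; 4320; (-66960); 380160; (-898560); 552960; 552960]);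
([:: 1;2;2]%N, true, [:: (-8640); 133920; (-760320); 1797120; (-1105920); (-1105920)])].

Definition rows31 : seq row := [::
([:: 0;2;0;2]%N, false, [:: 0; 0; (-12960); 110160; (-252720); 51840; 103680]);
([:: 1;1;0;2]%N, false, [:: 12960; (-110160); 252720; (-51840); (-103680)]);
([:: 2;2;1;3]%N, false, [:: (-12960); 149040; (-544320); 518400; 414720])].

Definition rows22 : seq row := [::
([:: 0;2;0;2]%N, false, [:: 0; (-3240); 40500; (-163620); 192780; 90720; (-25920)]);
([:: 0;2;1;1]%N, false, [:: 0; (-9720); 72900; (-116640); (-77760)]);
([:: 1;2;2;3]%N, false, [:: 6480; (-74520); 272160; (-259200); (-207360)]);
([:: 1;3;2;2]%N, false, [:: 6480; (-74520); 272160; (-259200); (-207360)])].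

Definition rows41 : seq row := [::
([:: 0;0;0;0;0]%N, false, [:: 0; (-72); 468; 1116; (-12240); 16704; 11520]);
([:: 0;0;1;2;2]%N, true, [:: (-576); 7520; (-38256); 90792; (-76288); (-40512); 23040; 5120]);
([:: 0;0;2;1;2]%N, true, [:: 736; (-6800); 17856; (-7712); 1408; (-30528); (-28160); (-5120)]);
([:: 0;0;2;2;1]%N, true, [:: 960; (-10560); 36960; (-34440); (-24000); 1920]);
([:: 0;1;0;2;2]%N, true, [:: (-3424); 38480; (-155184); 270248; (-174592); (-64128); 97280; 20480]);
([:: 0;1;2;0;2]%N, true, [:: 1824; (-20240); 83664; (-168048); 167872; 4608; (-107520); (-20480)]);
([:: 0;1;2;2;0]%N, true, [:: 2720; (-28080); 88080; (-53560); (-92160); (-9600); 5120]);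
([:: 0;1;2;2;3]%N, false, [:: (-3960); 46260; (-181080); 240480; (-4140); (-36000); 25920]);
([:: 0;1;2;3;2]%N, false, [:: (-1008); 11772; (-56106); 143550; (-174744); (-4320); 63360]);
([:: 0;1;3;2;2]%N, false, [:: 2088; (-17712); 46386; (-57150); 89964; (-8640); (-37440)]);
([:: 0;2;0;1;2]%N, true, [:: (-3072); 33280; (-121632); 161904; (-41216); (-27264); 46080; 10240]);
([:: 0;2;0;2;1]%N, true, [:: (-2624); 30080; (-126624); 241288; (-187072); (-48768); 102400; 20480]);
([:: 0;2;1;0;2]%N, true, [:: (-448); 6080; (-23808); 9176; 82496; (-36096); (-56320); (-10240)]);
([:: 0;2;1;2;0]%N, true, [:: 448; (-6080); 23808; (-9176); (-82496); 36096; 56320; 10240]);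
([:: 0;2;1;2;3]%N, false, [:: 144; (-24156); 237978; (-780570); 908712; (-132840); (-366480); 20160]);
([:: 0;2;1;3;2]%N, false, [:: 2736; (-23904); 29772; 238230; (-641502); 110520; 227160; (-10080)]);
([:: 0;2;2;0;1]%N, true, [:: 2624; (-30080); 126624; (-241288); 187072; 48768; (-102400); (-20480)]);
([:: 0;2;2;1;0]%N, true, [:: 3072; (-33280); 121632; (-161904); 41216; 27264; (-46080); (-10240)]);
([:: 0;2;2;1;3]%N, false, [:: (-4824); 47016; (-138978); 31410; 315828; (-63360); (-84960); 5760]);
([:: 0;2;2;3;1]%N, false, [:: 2016; (-17244); 22662; 145620; (-375282); 41760; 117720; (-4320)]);
([:: 0;2;2;3;3]%N, true, [:: 0; (-496); 6300; (-23334); 16454; 29886; 5748; (-64); (-960)]);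
([:: 0;2;3;1;2]%N, false, [:: 1584; (-18216); 63648; (-84870); 35622; 64980; 7200; (-2880)]);
([:: 0;2;3;2;1]%N, false, [:: 4104; (-62856); 360918; (-920340); 950022; (-73260); (-383760); 17280]);
([:: 0;2;3;2;3]%N, true, [:: 256; (-7952); 86436; (-445706); 1134790; (-1216518); 84856; 471904; (-24960)]);
([:: 0;2;3;3;2]%N, true, [:: 384; (-4728); 16836; 12576; (-196188); 358464; (-103140); (-154080); 8640]);
([:: 0;3;1;2;2]%N, false, [:: 1440; (-4500); (-71910); 392580; (-541890); 7920; 168120; (-10080)]);
([:: 0;3;2;1;2]%N, false, [:: 1800; (-7920); (-16110); 148500; (-226530); (-33300); 48960; (-2880)]);
([:: 0;3;2;2;1]%N, false, [:: 2520; (-17100); (-26100); 367560; (-655740); 40140; 214200; (-12960)]);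
([:: 0;3;2;2;3]%N, true, [:: (-64); 3144; (-36876); 185360; (-435804); 408144; (-868); (-157920); 8640]);
([:: 0;3;2;3;2]%N, true, [:: 64; (-832); (-1716); 47662; (-177202); 198786; 31816; (-52384); 1920]);
([:: 0;3;3;2;2]%N, true, [:: 320; (-2528); (-4380); 95090; (-310946); 327222; 6164; (-107456); 6720]);
([:: 1;1;2;2;3]%N, false, [:: 1440; (-13860); 37800; (-7380); (-50400); (-25920)]);
([:: 1;1;2;3;2]%N, false, [:: 3060; (-33300); 130140; (-217980); 105120; 129600]);
([:: 1;1;3;2;2]%N, false, [:: (-3420); 28260; (-64260); 31500; (-24480); (-25920)]);
([:: 1;2;0;0;2]%N, true, [:: (-2720); 28080; (-88080); 53560; 92160; 9600; (-5120)]);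
([:: 1;2;0;2;0]%N, true, [:: (-1824); 20240; (-83664); 168048; (-167872); (-4608); 107520; 20480]);
([:: 1;2;0;2;3]%N, false, [:: (-3672); 57168; (-340614); 918270; (-1017216); 86760; 395280; (-20160)]);
([:: 1;2;0;3;2]%N, false, [:: (-5760); 51660; (-133830); 41760; 171810; (-101880); (-63000); 10080]);
([:: 1;2;1;2;3]%N, false, [:: 3240; (-30600); 93240; (-102600); 31680; 63360]);
([:: 1;2;1;3;2]%N, false, [:: 1620; (-11160); 13860; 10800; 31680; 11520]);
([:: 1;2;2;0;0]%N, true, [:: 3424; (-38480); 155184; (-270248); 174592; 64128; (-97280); (-20480)]);
([:: 1;2;2;0;3]%N, false, [:: (-1008); 19692; (-105786); 212850; (-135324); 0; 56160; (-5760)]);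
([:: 1;2;2;1;3]%N, false, [:: 360; 1080; (-32760); 114120; (-77760); (-63360)]);
([:: 1;2;2;3;0]%N, false, [:: 1008; (-19512); 107496; (-192150); 43974; (-10080); (-34200); 4320]);
([:: 1;2;2;3;1]%N, false, [:: (-2700); 24840; (-66420); 30240; 43200]);
([:: 1;2;2;3;3]%N, true, [:: (-18); 156; 354; (-7476); 25008; (-20928); (-14592)]);
([:: 1;2;3;0;2]%N, false, [:: 4680; (-42480); 139770; (-237240); 288810; (-69300); (-145440); 2880]);
([:: 1;2;3;1;2]%N, false, [:: (-7740); 69120; (-196380); 224280; (-155520); (-167040)]);
([:: 1;2;3;2;0]%N, false, [:: 10512; (-96048); 218844; 165150; (-776214); 109260; 222480; (-17280)]);
([:: 1;2;3;2;1]%N, false, [:: (-540); 8640; (-46980); 96120; (-34560); (-51840)]);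
([:: 1;2;3;2;3]%N, true, [:: 3462; (-46968); 237018; (-546336); 567744; (-145920); (-296448)]);
([:: 1;2;3;3;2]%N, true, [:: (-396); 5904; (-35532); 111420; (-183888); 95040; 103680]);
([:: 1;3;0;2;2]%N, false, [:: (-3528); 22212; 25524; (-335430); 451926; 720; (-130680); 10080]);
([:: 1;3;1;2;2]%N, false, [:: 1620; (-11160); 13860; 10800; 31680; 11520]);
([:: 1;3;2;0;2]%N, false, [:: (-792); (-3852); 72216; (-292050); 401274; 37620; (-112320); 2880]);
([:: 1;3;2;1;2]%N, false, [:: 5220; (-54000); 192420; (-274680); 103680; 144000]);
([:: 1;3;2;2;0]%N, false, [:: 1440; (-29160); 207180; (-608040); 659880; (-4140); (-240120); 12960]);
([:: 1;3;2;2;1]%N, false, [:: (-3240); 34560; (-129600); 200880; (-86400); (-103680)]);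
([:: 1;3;2;2;3]%N, true, [:: (-1644); 21648; (-103956); 219804; (-199632); 50496; 103680]);
([:: 1;3;2;3;2]%N, true, [:: (-282); 3960; (-20646); 47760; (-42624); (-2304); 19968]);
([:: 1;3;3;2;2]%N, true, [:: (-1842); 23436; (-105822); 197580; (-137808); 28224; 83712]);
([:: 2;2;0;0;1]%N, true, [:: (-960); 10560; (-36960); 34440; 24000; (-1920)]);
([:: 2;2;0;1;0]%N, true, [:: (-736); 6800; (-17856); 7712; (-1408); 30528; 28160; 5120]);
([:: 2;2;0;1;3]%N, false, [:: (-936); 21384; (-132462); 343170; (-368208); 25380; 142200; (-7200)]);
([:: 2;2;0;3;1]%N, false, [:: (-3456); 35964; (-123462); 147960; (-25938); (-36540); 25920; 2880]);
([:: 2;2;0;3;3]%N, true, [:: (-320); 4548; (-28722); 104734; (-220422); 209370; 12100; (-78336); 2880]);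
([:: 2;2;1;0;0]%N, true, [:: 576; (-7520); 38256; (-90792); 76288; 40512; (-23040); (-5120)]);
([:: 2;2;1;0;3]%N, false, [:: (-864); (-4284); 85302; (-328410); 438588; (-52740); (-168120); 7200]);
([:: 2;2;1;1;3]%N, false, [:: 1440; (-18180); 76680; (-107820); (-7200); 25920]);
([:: 2;2;1;3;0]%N, false, [:: (-2016); 24984; (-113292); 225630; (-189558); 43740; 95040; (-2880)]);
([:: 2;2;1;3;1]%N, false, [:: 4500; (-41940); 129780; (-169740); 105120; 118080]);
([:: 2;2;1;3;3]%N, true, [:: (-210); 3714; (-24762); 74532; (-87792); 192; 29952]);
([:: 2;2;2;3;3]%N, false, [:: 0; 4536; (-57024); 246402; (-385560); 49248; 155520]);
([:: 2;2;3;0;1]%N, false, [:: 1656; (-31464); 191322; (-516960); 599238; (-69120); (-237240); 10080]);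
([:: 2;2;3;0;3]%N, true, [:: 64; (-1596); 24342; (-167294); 516762; (-632706); 52192; 234336; (-11520)]);
([:: 2;2;3;1;0]%N, false, [:: 5616; (-46584); 92592; 128610; (-454122); 89280; 142200; (-10080)]);
([:: 2;2;3;1;1]%N, false, [:: (-1260); 10620; (-26100); 20700; (-18720); (-14400)]);
([:: 2;2;3;1;3]%N, true, [:: 870; (-12882); 73734; (-202848); 259392; (-70656); (-133632)]);
([:: 2;2;3;2;3]%N, false, [:: 0; (-8424); 111456; (-521478); 949320; (-313632); (-466560)]);
([:: 2;2;3;3;0]%N, true, [:: 256; (-3060); 5622; 58024; (-292020); 426792; (-64292); (-156000); 8640]);
([:: 2;2;3;3;1]%N, true, [:: (-552); 7926; (-44436); 123996; (-175056); 70464; 103680]);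
([:: 2;2;3;3;2]%N, false, [:: 0; 1296; (-19764); 110322; (-255960); 152928; 155520]);
([:: 2;3;0;1;2]%N, false, [:: (-4824); 36576; (-60678); (-104670); 269748; (-41220); (-81720); 7200]);
([:: 2;3;0;2;1]%N, false, [:: (-8064); 90396; (-347958); 511740; (-215442); 23580; 144000; (-2880)]);
([:: 2;3;0;2;3]%N, true, [:: (-704); 12016; (-86580); 341842; (-761882); 796458; (-52976); (-311648); 15360]);
([:: 2;3;0;3;2]%N, true, [:: (-576); 6240; (-13260); (-63606); 300510; (-375630); 90048; 159648; (-11520)]);
([:: 2;3;1;0;2]%N, false, [:: 1584; (-3636); (-38682); 146790; (-124488); 36900; 55800; (-7200)]);
([:: 2;3;1;1;2]%N, false, [:: (-360); 12240; (-89640); 215280; (-92160); (-103680)]);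
([:: 2;3;1;2;0]%N, false, [:: (-3024); 35496; (-129168); 105750; 150138; (-13500); (-11520); 2880]);
([:: 2;3;1;2;1]%N, false, [:: 900; (-15840); 95940; (-229320); 132480; 132480]);
([:: 2;3;1;2;3]%N, true, [:: (-1146); 16680; (-93894); 256104; (-333984); 106368; 178176]);
([:: 2;3;1;3;2]%N, true, [:: 1926; (-25128); 119826; (-255960); 254304; (-93312); (-147456)]);
([:: 2;3;2;0;1]%N, false, [:: 1224; 2304; (-77382); 264420; (-276858); 73440; 119160; (-10080)]);
([:: 2;3;2;0;3]%N, true, [:: (-192); 4304; (-40428); 183438; (-400810); 373110; (-51900); (-158272); 10560]);
([:: 2;3;2;1;0]%N, false, [:: 1584; (-32256); 191988; (-462150); 427662; (-41760); (-173880); 10080]);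
([:: 2;3;2;1;1]%N, false, [:: (-4140); 40680; (-131580); 154800; (-37440); (-80640)]);
([:: 2;3;2;1;3]%N, true, [:: (-1026); 14052; (-73086); 182604; (-228432); 89664; 132864]);
([:: 2;3;2;2;3]%N, false, [:: 0; 9072; (-114048); 492804; (-771120); 98496; 311040]);
([:: 2;3;2;3;0]%N, true, [:: 192; (-4024); 36612; (-169176); 392996; (-396084); 46152; 158336; (-9600)]);
([:: 2;3;2;3;1]%N, true, [:: 1260; (-16692); 81804; (-183768); 196512; (-68736); (-118272)]);
([:: 2;3;2;3;2]%N, false, [:: 0; (-648); 4212; 10044; (-110160); 150336; 103680]);
([:: 2;3;3;0;2]%N, true, [:: 192; (-1728); (-1092); 41958; (-95682); 24078; 13092; (-5568); 2880]);
([:: 2;3;3;1;2]%N, true, [:: (-1314); 16740; (-75222); 135900; (-77328); (-1728); 43776]);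
([:: 2;3;3;2;0]%N, true, [:: 448; (-4280); 2628; 94792; (-364268); 426972; (-31880); (-160256); 9600]);
([:: 2;3;3;2;1]%N, true, [:: (-2100); 27804; (-134052); 281592; (-240672); 39552; 118272]);
([:: 2;3;3;2;2]%N, false, [:: 0; (-648); 10692; (-64476); 162000; (-108864); (-103680)]);
([:: 3;3;0;2;2]%N, true, [:: (-320); 2420; 5622; (-99626); 315266; (-323766); (-6164); 107456; (-6720)]);
([:: 3;3;1;2;2]%N, true, [:: 1950; (-24678); 110358; (-201900); 134352; (-28224); (-83712)]);
([:: 3;3;2;0;2]%N, true, [:: (-64); 724; 2958; (-52198); 181522; (-195330); (-31816); 52384; (-1920)]);
([:: 3;3;2;1;2]%N, true, [:: 390; (-5202); 25182; (-52080); 39168; 2304; (-19968)]);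
([:: 3;3;2;2;0]%N, true, [:: 64; (-3252); 38118; (-189896); 440124; (-404688); 868; 157920; (-8640)]);
([:: 3;3;2;2;1]%N, true, [:: 1752; (-22890); 108492; (-224124); 196176; (-50496); (-103680)]);
([:: 3;3;2;2;2]%N, false, [:: 0; (-5184); 64476; (-273618); 411480; (-28512); (-155520)])].

Definition rows32 : seq row := [::
([:: 0;0;0;0;0]%N, false, [:: (-180); 2826; (-16722); 44334; (-44136); (-5472); 14976]);
([:: 0;0;1;2;2]%N, true, [:: 432; (-3560); 5712; 11736; (-11264); (-33216); (-23040); (-5120)]);
([:: 0;0;2;1;2]%N, true, [:: 2128; (-27000); 125568; (-251096); 164544; 75456; (-74240); (-15360)]);
([:: 0;1;0;2;2]%N, true, [:: 1328; (-15720); 67248; (-118696); 46464; 72576; 5120]);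
([:: 0;1;2;0;2]%N, true, [:: 1232; (-14840); 64032; (-120664); 106816; (-30336); (-102400); (-20480)]);
([:: 0;1;2;2;3]%N, false, [:: 4536; (-54144); 223902; (-354330); 137088; 27360; (-80640)]);
([:: 0;1;3;2;2]%N, false, [:: 2304; (-29916); 135918; (-243450); 128412; 0; (-72000)]);
([:: 0;2;0;1;2]%N, true, [:: (-368); 7720; (-52608); 144136; (-129344); (-36096); 56320; 10240]);
([:: 0;2;1;2;3]%N, false, [:: 2880; (-30420); 82890; 8280; (-209430); 102600; 79560; (-7200)]);
([:: 0;2;2;0;1]%N, true, [:: 368; (-7720); 52608; (-144136); 129344; 36096; (-56320); (-10240)]);
([:: 0;2;2;1;3]%N, false, [:: 4536; (-50724); 207792; (-340110); 125118; 108000; (-32760); (-1440)]);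
([:: 0;2;2;3;3]%N, true, [:: (-36); 226; 1854; (-24654); 87658; (-79998); (-63348); 64; 960]);
([:: 0;2;3;1;2]%N, false, [:: 504; (-1656); (-17622); 92970; (-135468); 74700; 63720; (-10080)]);
([:: 0;2;3;2;3]%N, true, [:: (-8); 2316; (-28452); 136042; (-311610); 341130; (-101600); (-158688); 11520]);
([:: 0;3;1;2;2]%N, false, [:: 360; (-2880); 33930; (-173340); 297810; (-75240); (-117000); 7200]);
([:: 0;3;2;1;2]%N, false, [:: 0; (-4140); 43830; (-205020); 403830; (-151020); (-186480); 11520]);
([:: 0;3;2;2;3]%N, true, [:: (-72); 28; 10980; (-87438); 271870; (-353454); 77232; 154144; (-7680)]);
([:: 0;3;3;2;2]%N, true, [:: (-4); (-1214); 16230; (-85054); 218002; (-250974); 38564; 102784; (-4800)]);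
([:: 1;1;2;2;3]%N, false, [:: (-1980); 23220; (-97380); 166140; (-64800); (-83520)]);
([:: 1;1;3;2;2]%N, false, [:: 1440; (-9450); 2340; 63630; (-45360); (-41760)]);
([:: 1;2;0;0;2]%N, true, [:: (-1232); 14840; (-64032); 120664; (-106816); 30336; 102400; 20480]);
([:: 1;2;0;2;3]%N, false, [:: (-576); 12744; (-50292); (-6210); 205722; (-47880); (-53640); 7200]);
([:: 1;2;1;2;3]%N, false, [:: (-2700); 21240; (-33660); (-56160); 83520; 46080]);
([:: 1;2;2;0;0]%N, true, [:: (-1328); 15720; (-67248); 118696; (-46464); (-72576); (-5120)]);
([:: 1;2;2;0;3]%N, false, [:: (-1080); 13320; (-65970); 116460; 4950; (-76320); (-21960); 1440]);
([:: 1;2;2;1;3]%N, false, [:: (-1260); 8280; (-1620); (-59760); 48960; 34560]);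
([:: 1;2;2;3;3]%N, true, [:: 126; (-1398); 4182; 3156; (-28464); 20928; 14592]);
([:: 1;2;3;0;2]%N, false, [:: 2016; (-33084); 194022; (-488610); 490968; (-102060); (-227880); 10080]);
([:: 1;2;3;1;2]%N, false, [:: (-1800); 18000; (-64800); 110880; (-80640); (-69120)]);
([:: 1;2;3;2;3]%N, true, [:: (-1722); 22200; (-104430); 221736; (-231072); 103296; 147456]);
([:: 1;3;0;2;2]%N, false, [:: (-2664); 32796; (-169848); 416790; (-426222); 75240; 189000; (-7200)]);
([:: 1;3;1;2;2]%N, false, [:: (-540); 900; 22860; (-84780); 41760; 48960]);
([:: 1;3;2;0;2]%N, false, [:: (-4536); 58284; (-267732); 559350; (-540918); 123660; 267120; (-11520)]);
([:: 1;3;2;1;2]%N, false, [:: 900; (-7920); 17820; 6120; (-28800); (-17280)]);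
([:: 1;3;2;2;3]%N, true, [:: 1062; (-13512); 62394; (-129864); 138144; (-74112); (-89088)]);
([:: 1;3;3;2;2]%N, true, [:: 894; (-10998); 47430; (-84660); 68400; (-40896); (-54528)]);
([:: 2;2;0;0;1]%N, true, [:: (-2128); 27000; (-125568); 251096; (-164544); (-75456); 74240; 15360]);
([:: 2;2;0;1;3]%N, false, [:: 1224; (-18756); 82548; (-128430); 48222; 16380; (-24480); 2880]);
([:: 2;2;0;3;3]%N, true, [:: (-50); 589; 303; (-21602); 76774; (-80526); (-6248); 26848; (-1920)]);
([:: 2;2;1;0;0]%N, true, [:: (-432); 3560; (-5712); (-11736); 11264; 33216; 23040; 5120]);
([:: 2;2;1;0;3]%N, false, [:: (-720); 14580; (-75870); 148140; (-101070); (-540); 47520; (-2880)]);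
([:: 2;2;1;1;3]%N, false, [:: (-540); 8820; (-48780); 102060; (-41760); (-48960)]);
([:: 2;2;1;3;3]%N, true, [:: 240; (-3435); 18678; (-47592); 54816; (-13440); (-24576)]);
([:: 2;2;2;3;3]%N, false, [:: 0; (-2268); 27216; (-108297); 138348; 27216; (-36288)]);
([:: 2;2;3;0;1]%N, false, [:: (-504); 4176; (-6678); (-19710); 52848; (-15840); (-23040)]);
([:: 2;2;3;0;3]%N, true, [:: (-4); 194; (-4434); 30566; (-81526); 75342; 6248; (-26848); 1920]);
([:: 2;2;3;1;1]%N, false, [:: 360; (-2070); (-5580); 49050; (-55440); (-44640)]);
([:: 2;2;3;1;3]%N, true, [:: (-186); 2814; (-16410); 45432; (-56544); 13440; 24576]);
([:: 2;2;3;2;3]%N, false, [:: 0; (-1296); 17172; (-80514); 147096; (-49248); (-72576)]);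
([:: 2;3;0;1;2]%N, false, [:: (-2304); 33696; (-168048); 376650; (-364482); (-540); 148320; (-2880)]);
([:: 2;3;0;2;3]%N, true, [:: (-200); 3012; (-20316); 67432; (-85860); (-14352); 50956; 2208; (-2880)]);
([:: 2;3;1;0;2]%N, false, [:: (-2520); 18720; (-40950); 16920; 12690; (-26820); (-10080); 2880]);
([:: 2;3;1;1;2]%N, false, [:: 3780; (-37440); 127620; (-184680); 97920; 109440]);
([:: 2;3;1;2;3]%N, true, [:: 420; (-5016); 21012; (-38724); 44976; (-40128); (-43776)]);
([:: 2;3;2;0;1]%N, false, [:: (-3456); 37404; (-141822); 223650; (-130068); (-31680); 54720]);
([:: 2;3;2;0;3]%N, true, [:: (-72); 1340; (-10116); 42582; (-97162); 69630; 63348; (-64); (-960)]);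
([:: 2;3;2;1;1]%N, false, [:: 2340; (-23580); 81180; (-112500); 44640; 66240]);
([:: 2;3;2;1;3]%N, true, [:: (-18); 156; 354; (-7476); 25008; (-20928); (-14592)]);
([:: 2;3;2;2;3]%N, false, [:: 0; 648; (-9396); 49572; (-107568); 57024; 62208]);
([:: 2;3;3;0;2]%N, true, [:: (-8); (-2196); 32244; (-167618); 378462; (-347514); 50644; 156480; (-8640)]);
([:: 2;3;3;1;2]%N, true, [:: 1518; (-19668); 92490; (-191652); 179184; (-63168); (-103680)]);
([:: 2;3;3;2;2]%N, false, [:: 0; (-1296); 20412; (-117774); 283176; (-178848); (-176256)]);
([:: 3;3;0;2;2]%N, true, [:: (-50); 1997; (-20361); 94018; (-222754); 245790; (-38564); (-102784); 4800]);
([:: 3;3;1;2;2]%N, true, [:: (-840); 10377; (-45162); 82500; (-70128); 40896; 54528]);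
([:: 3;3;2;0;2]%N, true, [:: (-36); 1538; (-19242); 105366; (-281374); 343086; (-77232); (-154144); 7680]);
([:: 3;3;2;1;2]%N, true, [:: (-954); 12270; (-57858); 125544; (-141600); 74112; 89088]);
([:: 3;3;2;2;2]%N, false, [:: 0; 4212; (-55404); 257013; (-461052); 143856; 222912])].

Definition rows221 : seq row := [::
([:: 0;0;0;0;0]%N, false, [:: 180; (-2538); 12906; (-26442); 11448; 16416; 1152]);
([:: 0;0;1;2;2]%N, true, [:: 1760; (-19280); 72960; (-106960); 35200; 39360; (-17920); (-5120)]);
([:: 0;1;0;2;2]%N, true, [:: 3520; (-38560); 145920; (-213920); 70400; 78720; (-35840); (-10240)]);
([:: 0;1;2;2;0]%N, true, [:: (-1760); 19280; (-72960); 106960; (-35200); (-39360); 17920; 5120]);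
([:: 0;1;2;2;3]%N, false, [:: 3960; (-41580); 148500; (-203940); 77220; 47520; (-31680)]);
([:: 0;1;2;3;2]%N, false, [:: 1080; (-11340); 40500; (-55620); 21060; 12960; (-8640)]);
([:: 0;2;1;2;0]%N, true, [:: (-3520); 38560; (-145920); 213920; (-70400); (-78720); 35840; 10240]);
([:: 0;2;1;2;3]%N, false, [:: 6840; (-71820); 256500; (-352260); 133380; 82080; (-54720)]);
([:: 0;2;1;3;2]%N, false, [:: 2160; (-4320); (-77220); 309420; (-274860); (-36180); 85320; (-4320)]);
([:: 0;2;2;3;1]%N, false, [:: (-1800); 19260; (-68400); 96120; (-61560); (-7740); 25560; (-1440)]);
([:: 0;2;2;3;3]%N, true, [:: 656; (-7784); 30288; (-37756); (-32); (-8244); (-19492); (-2336); 960]);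
([:: 0;2;3;3;2]%N, true, [:: 72; (-900); (-828); 44316; (-176544); 203364; 27540; (-56160); 2880]);
([:: 0;3;1;2;2]%N, false, [:: (-3240); 15660; 36720; (-253800); 253800; 23220; (-76680); 4320]);
([:: 0;3;2;2;1]%N, false, [:: 1800; (-19260); 68400; (-96120); 61560; 7740; (-25560); 1440]);
([:: 0;3;2;2;3]%N, true, [:: 328; (-6052); 42324; (-134708); 174944; (-35532); (-23516); 26912; (-960)]);
([:: 0;3;2;3;2]%N, true, [:: 144; (-1800); 12384; (-62028); 178272; (-196452); (-27540); 56160; (-2880)]);
([:: 1;1;2;2;3]%N, false, [:: (-3600); 34200; (-100800); 84600; 14400; (-28800)]);
([:: 1;1;2;3;2]%N, false, [:: (-720); 6840; (-20160); 16920; 2880; (-5760)]);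
([:: 1;2;1;2;3]%N, false, [:: (-2880); 27360; (-80640); 67680; 11520; (-23040)]);
([:: 1;2;1;3;2]%N, false, [:: 720; (-6840); 20160; (-16920); (-2880); 5760]);
([:: 1;2;2;3;0]%N, false, [:: (-5040); 52560; (-188100); 256140; (-71820); (-74340); 29160; 1440]);
([:: 1;2;2;3;1]%N, false, [:: 6480; (-61560); 181440; (-152280); (-25920); 51840]);
([:: 1;2;2;3;3]%N, true, [:: (-888); 11124; (-48240); 79068; (-27216); (-10944); 14592]);
([:: 1;2;3;3;2]%N, true, [:: (-1296); 17064; (-80352); 154980; (-90288); (-25920); 34560]);
([:: 1;3;2;2;0]%N, false, [:: (-5760); 60840; (-216900); 300060; (-138780); (-55260); 57240; (-1440)]);
([:: 1;3;2;2;3]%N, true, [:: 96; (-1728); 11520; (-33636); 34992; 7488; (-9984)]);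
([:: 1;3;2;3;2]%N, true, [:: 648; (-9612); 53136; (-129060); 111024; 25920; (-34560)]);
([:: 2;2;2;3;3]%N, false, [:: 0; (-5184); 62208; (-247536); 316224; 62208; (-82944)]);
([:: 2;2;3;3;0]%N, true, [:: (-220); 4702; (-36546); 125852; (-174080); 38988; 23516; (-26912); 960]);
([:: 2;2;3;3;1]%N, true, [:: (-420); 5454; (-25128); 46596; (-24624); (-7488); 9984]);
([:: 2;2;3;3;2]%N, false, [:: 0; 3888; (-46656); 185652; (-237168); (-46656); 62208]);
([:: 2;3;2;3;0]%N, true, [:: (-440); 5084; (-18732); 20044; 1760; 15156; 19492; 2336; (-960)]);
([:: 2;3;2;3;1]%N, true, [:: 240; (-3672); 21024; (-53148); 47952; 10944; (-14592)]);
([:: 2;3;2;3;2]%N, false, [:: 0; 1296; (-15552); 61884; (-79056); (-15552); 20736])].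

Definition factored_denom : pol :=
  pscale 1080 (pmul [:: 0; 1] (pmul [:: 2; 1] (iter 4 (pmul [:: 1; (-4)]) [:: 1]))).

(** The expanded form is used in the check, the factored form to prove nonvanishing. *)
Definition denom : pol := Eval vm_compute in factored_denom.

Definition rows_of (t : magma) : seq row :=
  match t with
  | Prod (Prod (Prod (Prod _ _) _) _) _ => rows41
  | Prod (Prod (Prod _ _) _) (Prod _ _) => rows32
  | Prod (Prod (Prod _ _) (Prod _ _)) _ => rows221
  | Prod (Prod (Prod _ _) _) _ => rows31
  | Prod (Prod _ _) (Prod _ _) => rows22
  | Prod (Prod _ _) _ => rows3
  | Prod _ _ => rows2
  | Gen _ => rows1
  end.

(* The leaf words of the images of [t] under its symmetries: the rows are
   stored up to these.  Oriented subtrees of equal size have the same shape in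
   degree at most 5. *)
Fixpoint twists (t : magma) : seq (seq nat) :=
  match t with
  | Gen i => [:: [:: i]]
  | Prod u v =>
      let lu := twists u in let lv := twists v in
      [seq a ++ b | a <- lu, b <- lv] ++
      (if magma_size u == magma_size v then [seq b ++ a | a <- lu, b <- lv]
       else [::])
  end.

Definition assoc2 (a b c d e : magma) : seq (Z * magma) :=
  [:: (1, Prod (Prod (Prod (Prod a b) c) d) e);
      ((-1), Prod (Prod (Prod a (Prod b c)) d) e);
      ((-1), Prod (Prod (Prod a b) c) (Prod d e));
      (1, Prod (Prod a (Prod b c)) (Prod d e))].

Definition id5 (a b b' c d : magma) : seq (Z * magma) :=
  assoc2 a b c d b' ++ assoc2 c b d a b' ++ assoc2 d b a c b'.

(** Modulo commutativity (x, y, z) = -(z, y, x), so this linearization alternates in a, c, d and is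
    symmetric in b, b'. On five variables it depends, up to sign, only on the pair {b, b'}: this is
    where the number ten comes from. *)
Definition lin5 (a b b' c d : magma) : seq (Z * magma) :=
  id5 a b b' c d ++ id5 a b' b c d.

(* With [g_B] the ten linearized identities, [correction t] is the combination
   [\sum_B phi_B(t) g_B] for functionals with [phi_B(g_B') = 12] if [B = B'] and 0
   otherwise, so that [nform] is 12 times a projection killing the [g_B]. *)
Definition correction (t : magma) : seq (Z * magma) :=
  if t is Prod (Prod (Prod (Prod (Gen x) (Gen y)) (Gen z)) (Gen u)) (Gen v) then
    let L a b b' c d := lin5 (Gen a) (Gen b) (Gen b') (Gen c) (Gen d) in
    (L x y v z u ++ L y x v z u) ++ (L x y z u v ++ L y x z u v)
  else [::].

Definition coef (t : magma) (s : seq (Z * magma)) : Z :=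
  foldr (fun p c => if eqc p.2 t then Z.add p.1 c else c) 0 s.

Definition nform (t : magma) : seq (Z * magma) :=
  (12, t) :: [seq (Z.opp p.1, p.2) | p <- correction t].

Definition word (w l : seq nat) (x : nat) : nat := nth 0%N w (index x l).

Definition cert_sum (t t' : magma) : pol :=
  let ls := twists t in
  foldr (fun r s => padd (pmul r.2
      (foldr (fun l s => padd (gcoord r.1.2 (pval (word r.1.1 l) t')) s) [::] ls)) s)
    [::] (rows_of t).

(** Entry (t, t') of the left inverse property: [cert_sum t t'] must equal [denom] times the
    coefficient of t in [nform t']. With the leaves in increasing order, an oriented t amounts to a
    shape. *)
Definition cert_ok (n : nat) : bool :=
  let ts := reps n in
  all (fun t => all (fun t' => all (Z.eqb 0)
      (padd (pscale (Z.opp (coef t (nform t'))) denom) (cert_sum t t'))) ts)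
    (oriented_trees n (iota 0 n)).

Local Close Scope Z_scope.

Lemma all_cert_ok : all cert_ok [:: 1; 2; 3; 4; 5]%N = true.
Proof. vm_cast_no_check (erefl true). Qed.

Lemma cert_okP n : (0 < n <= 5)%N -> cert_ok n.
Proof.
move=> n_bnd; apply: (allP all_cert_ok).
by case: n n_bnd => [|[|[|[|[|[|n]]]]]].
Qed.

(** * Evaluation in S(alpha, E) *)

Section Values.
Variables (F : fieldType) (alpha : F) (E : vectType F) (bil : {symmetric E}).
Local Notation mul := (Smul alpha bil).
Local Notation delta := (alpha * (1 - alpha)).

Definition gvalF : (nat -> nat) -> magma -> (bool * bool) * (F * F) :=
  gval 0 1 +%R *%R delta (- delta ^+ 2) (1 - 2 * delta) (- 1).

Definition gmulF := gmul 0 +%R *%R delta (- delta ^+ 2) (1 - 2 * delta) (- 1 : F).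

Lemma gmulF_comm : commutative gmulF.
Proof.
move=> [[i j] [x0 x1]] [[k l] [y0 y1]]; rewrite /gmulF /=.
rewrite [i (+) k]addbC [j (+) l]addbC; congr pair.
by case: i; case: j; case: k; case: l => //; congr pair; ring.
Qed.

Lemma gvalF_Prod b u v : gvalF b (Prod u v) = gmulF (gvalF b u) (gvalF b v).
Proof. by []. Qed.

Definition nb_e (b : nat -> nat) (t : magma) : nat :=
  count (fun i => b i == 2%N) (leaves t).
Definition nb_f (b : nat -> nat) (t : magma) : nat :=
  count (fun i => 2 < b i)%N (leaves t).

Lemma gvalF_grade b t : (gvalF b t).1 = (odd (nb_e b t), odd (nb_f b t)).
Proof.
rewrite /nb_e /nb_f; elim: t => [i|u IHu v IHv].
  by rewrite /gvalF /gval /=; case: (b i) => [|[|[|k]]].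
rewrite gvalF_Prod /= !count_cat !oddD; move: IHu IHv.
case: (gvalF b u) => [[i j] [x0 x1]]; case: (gvalF b v) => [[k l] [y0 y1]].
by case=> -> -> [-> ->].
Qed.

(** In odd bidegree [realize] ignores the second coordinate, and in bidegree (odd, odd) both; the
    vanishing of these coordinates has to be known separately. *)
Definition reduced (x : (bool * bool) * (F * F)) :=
  (x.1.1 || x.1.2 -> x.2.2 = 0) /\ (x.1.1 && x.1.2 -> x.2.1 = 0).

Lemma gvalF_reduced b t : reduced (gvalF b t).
Proof.
elim: t => [i|u _ v _].
  by rewrite /gvalF /gval /=; case: (b i) => [|[|[|k]]].
rewrite gvalF_Prod.
case: (gvalF b u) => [[i j] [x0 x1]]; case: (gvalF b v) => [[k l] [y0 y1]].
by case: i; case: j; case: k; case: l.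
Qed.

Lemma bilC e f : bil e f = bil f e.
Proof. by rewrite hermC /= expr0 mul1r. Qed.

Lemma SmulC x y : mul x y = mul y x.
Proof.
case: x => [[x1 x2] e]; case: y => [[y1 y2] f]; rewrite /Smul bilC.
congr (_, _, _); [by rewrite [x1 * _]mulrC|by rewrite [x2 * _]mulrC|exact: addrC].
Qed.

Lemma Smul_linl y : linear (mul^~ y).
Proof.
case: y => [[y1 y2] v] c [[x1 x2] e] [[w1 w2] f].
rewrite /Smul /=; congr (_, _, _).
- by rewrite linearPl /= -[c *: x1]/(c * x1) -[c *: (_ - _)]/(c * (_ - _)); ring.
- by rewrite linearPl /= -[c *: x2]/(c * x2) -[c *: (_ - _)]/(c * (_ - _)); ring.
- pose a x1 x2 : F := x1 * alpha + x2 * (1 - alpha).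
  rewrite -[RHS]/(c *: (a x1 x2 *: v + a y1 y2 *: e)
                  + (a w1 w2 *: v + a y1 y2 *: f)).
  rewrite -[LHS]/(a (c * x1 + w1) (c * x2 + w2) *: v
                  + a y1 y2 *: (c *: e + f)).
  rewrite !scalerDr !scalerA addrACA -scalerDl [a y1 y2 * c]mulrC.
  by congr (_ *: _ + _); rewrite /a; ring.
Qed.

Lemma Smul_linr x : linear (mul x).
Proof. by move=> c y z; rewrite ![mul x _]SmulC Smul_linl. Qed.

Variables (e f : E).
Hypotheses (ef0 : bil e f = 0).
Local Notation q := (bil e e).
Local Notation r := (bil f f).

(* The letters 0, 1, 2, 3 stand for the unit z1 + z2, for
   m = (1 - alpha)^2 z1 + alpha^2 z2, for e and for f; the structure constants
   then only depend on delta = alpha (1 - alpha), up to the factors q and r. *)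
Definition letter (i : nat) : Salg E :=
  match i with
  | 0 => (1, 1, 0)
  | 1 => ((1 - alpha) ^+ 2, alpha ^+ 2, 0)
  | 2 => (0, 0, e)
  | _ => (0, 0, f)
  end.

Definition realize (x : (bool * bool) * (F * F)) : Salg E :=
  match x with
  | ((false, false), (x0, x1)) =>
      (x0 + x1 * (1 - alpha) ^+ 2, x0 + x1 * alpha ^+ 2, 0)
  | ((true, false), (x0, _)) => (0, 0, x0 *: e)
  | ((false, true), (x0, _)) => (0, 0, x0 *: f)
  | _ => 0
  end.

(** With m e = delta e, m f = delta f and e f = 0, the only products outside the table in delta are
    e e = q (1 - m) and f f = r (1 - m), which give the scalar in front. *)
Lemma realize_mul x y :
  mul (realize x) (realize y)
  = (q ^+ (x.1.1 && y.1.1) * r ^+ (x.1.2 && y.1.2)) *: realize (gmulF x y).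
Proof.
case: x => [[i j] [x0 x1]]; case: y => [[k l] [y0 y1]].
have fe0 : bil f e = 0 by rewrite bilC.
have pairZ c a1 a2 (v : E) : c *: ((a1, a2, v) : Salg E) = (c * a1, c * a2, c *: v).
  by [].
have pair0 : (0 : Salg E) = (0, 0, 0) by [].
case: i; case: j; case: k; case: l; rewrite /= ?pair0 ?pairZ /Smul
   ?linear0l ?linear0r ?linearZl_LR ?linearZr_LR /= ?ef0 ?fe0
   ?scaler0 ?addr0 ?add0r ?scale0r ?scalerA;
  try (congr (_, _, _); try ring;
    by [rewrite ?(mulr0, mul0r, addr0, scale0r)|congr (_ *: _); ring]).
all: by rewrite !(mul0r, mulr0, addr0, subr0, scale0r, scaler0).
Qed.

(** Half of a sum is the sum of the halves, plus one when both terms are odd. This is when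
    [realize_mul] releases a factor q or r, so the exponents depend only on the numbers of
    letters. *)
Lemma eval_letters b t :
  magma_eval mul (letter \o b) t
  = (q ^+ (nb_e b t)./2 * r ^+ (nb_f b t)./2) *: realize (gvalF b t).
Proof.
have ZE (c a1 a2 : F) (v : E) :
  c *: ((a1, a2, v) : Salg E) = (c * a1, c * a2, c *: v) by [].
elim: t => [i|u IHu v IHv] /=.
  rewrite /nb_e /nb_f /gvalF /gval /=; case: (b i) => [|[|[|k]]] /=;
    by rewrite mulr1 ?scale1r; congr (_, _, _); rewrite ?scale1r //; ring.
have ZM c d x y : mul (c *: x) (d *: y) = (c * d) *: mul x y.
  have lZl a z w : mul (a *: z) w = a *: mul z w.
    have m0 : mul 0 w = 0.
      by apply: (addIr (mul 0 w)); have := Smul_linl w 1 0 0;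
        rewrite scale1r addr0 scale1r add0r => <-.
    by have := Smul_linl w a z 0; rewrite !addr0 m0 addr0.
  by rewrite lZl SmulC lZl SmulC scalerA mulrC mulrC.
rewrite IHu IHv ZM realize_mul scalerA -gvalF_Prod; congr (_ *: _).
rewrite !gvalF_grade /= /nb_e /nb_f /= !count_cat !halfD !exprD; ring.
Qed.

Hypotheses (q0 : q != 0) (r0 : r != 0) (alpha_half : 2 * alpha != 1).

(** All monomials of a multilinear P use each variable once, so they share the scalar c and the
    parities. Cancelling c leaves an equation in S(alpha, E), from which the coordinates are
    read. *)
Lemma gcoord_sum_eq0 n (P : seq (F * magma)) b k :
  all (multilinear n) (map snd P) ->
  (forall s, \sum_(p <- P) p.1 *: magma_eval mul s p.2 = 0) ->
  \sum_(p <- P) p.1 * gcoord k (gvalF b p.2) = 0.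
Proof.
move=> /allP Pn P_id; have := P_id (letter \o b).
pose ne := count (fun i => b i == 2%N) (iota 0 n).
pose nf := count (fun i => 2 < b i)%N (iota 0 n).
have nbP p : p \in P -> nb_e b p.2 = ne /\ nb_f b p.2 = nf.
  by move=> pP; split; apply/permP/Pn/map_f.
set c := q ^+ ne./2 * r ^+ nf./2.
have c0 : c != 0 by rewrite mulf_neq0 // expf_neq0.
have -> : \sum_(p <- P) p.1 *: magma_eval mul (letter \o b) p.2 =
          c *: \sum_(p <- P) p.1 *: realize (gvalF b p.2).
  rewrite scaler_sumr !big_seq; apply: eq_bigr => p pP.
  by rewrite eval_letters !scalerA mulrC; have [-> ->] := nbP p pP.
move/eqP; rewrite scaler_eq0 (negbTE c0) /= => /eqP S0.
pose y k := \sum_(p <- P) p.1 * gcoord k (gvalF b p.2).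
have gP p : p \in P ->
    gvalF b p.2 = ((odd ne, odd nf), (gcoord false (gvalF b p.2), gcoord true (gvalF b p.2))).
  move=> pP; rewrite [LHS]surjective_pairing gvalF_grade.
  by have [-> ->] := nbP p pP; rewrite /gcoord -surjective_pairing.
have y_eq0 j : (forall p, p \in P -> gcoord j (gvalF b p.2) = 0) -> y j = 0.
  move=> c_eq0; rewrite /y big_seq big1 // => p /c_eq0 ->; exact: mulr0.
have sndP (v : E) : (forall p, p \in P ->
    (realize (gvalF b p.2)).2 = gcoord false (gvalF b p.2) *: v) -> y false *: v = 0.
  move=> Dv; have := congr1 snd S0; rewrite raddf_sum /= => <-.
  rewrite scaler_suml !big_seq; apply: eq_bigr => p pP.
  by rewrite -scalerA -Dv.
have redP p : p \in P -> reduced (gvalF b p.2) by move=> _; exact: gvalF_reduced.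
have [e0 f0] : e != 0 /\ f != 0.
  by split; [move: q0|move: r0]; apply: contraNneq => ->; rewrite linear0r.
rewrite -/(y k); case Dg: (odd ne || odd nf).
  have y1 : y true = 0.
    by apply: y_eq0 => p pP; have [+ _] := redP p pP; rewrite gP //=; exact.
  case: k => //; case one: (odd ne) Dg gP => Dg gP; case onf: (odd nf) Dg gP => Dg gP //.
  - by apply: y_eq0 => p pP; have [_ +] := redP p pP; rewrite gP //=; exact.
  - have /eqP : y false *: e = 0 by apply: sndP => p pP; rewrite gP.
    by rewrite scaler_eq0 (negbTE e0) orbF => /eqP.
  - have /eqP : y false *: f = 0 by apply: sndP => p pP; rewrite gP.
    by rewrite scaler_eq0 (negbTE f0) orbF => /eqP.
move: Dg gP => /norP[/negbTE-> /negbTE->] gP.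
have yE a (g : Salg E -> F) : g 0 = 0 -> {morph g : x z / x + z} ->
    (forall c x, g (c *: x) = c * g x) ->
    (forall p, p \in P -> g (realize (gvalF b p.2)) =
       gcoord false (gvalF b p.2) + gcoord true (gvalF b p.2) * a) ->
    y false + y true * a = 0.
  move=> g0 gD gZ Dg; have := congr1 g S0; rewrite g0 (big_morph g gD g0) => <-.
  rewrite /y mulr_suml -big_split !big_seq; apply: eq_bigr => p pP /=.
  by rewrite gZ Dg // mulrDr mulrA.
have y1 : y false + y true * (1 - alpha) ^+ 2 = 0.
  by apply: (yE _ (fun x => x.1.1)) => // p pP; rewrite gP.
have y2 : y false + y true * alpha ^+ 2 = 0.
  by apply: (yE _ (fun x => x.1.2)) => // p pP; rewrite gP.
(* The z_1 and z_2 components differ by [y true] times (1 - alpha)^2 - alpha^2 = 1 - 2 alpha: 1 and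
   m are independent because alpha is not 1/2. *)
have yt : y true = 0.
  have : y true * (1 - 2 * alpha) = 0.
    by rewrite -[RHS](subrr 0) -{1}y1 -y2; ring.
  move/eqP; rewrite mulf_eq0 subr_eq0 [1 == _]eq_sym (negbTE alpha_half) orbF.
  by move/eqP.
by case: k => //; move: y1; rewrite yt mul0r addr0.
Qed.

End Values.

(** * Two orthogonal anisotropic vectors *)

Section OrthogonalPair.
Variables (F : fieldType) (E : vectType F) (bil : {symmetric E}).
Hypothesis two_neq0 : 2 != 0 :> F.

(** If u and v are both isotropic, then <u + v, u + v> = 2 <u, v>. *)
Lemma exists_anisotropic (V : {vspace E}) u v : u \in V -> v \in V ->
  bil u v != 0 -> exists2 e, e \in V & bil e e != 0.
Proof.
move=> uV vV uv; have [uu|] := eqVneq (bil u u) 0; last by exists u.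
have [vv|] := eqVneq (bil v v) 0; last by exists v.
exists (u + v); first exact: memvD.
rewrite linearDl /= !linearDr /= uu vv add0r addr0 bilC -mulr2n -mulr_natl.
by rewrite mulf_neq0 // bilC.
Qed.

Lemma exists_orthogonal_pair : (2 <= \dim {:E})%N -> nondegenerate bil ->
  exists e f, [/\ bil e f = 0, bil e e != 0 & bil f f != 0].
Proof.
move=> dimE /eqP nondeg.
have nondegP u : u != 0 -> exists v, bil u v != 0.
  move=> u0; have : u \notin orthov bil fullv by rewrite nondeg memv0.
  by case/mem_orthovPn => v _ uv; exists v.
have [e _ ee] : exists2 e, e \in {:E}%VS & bil e e != 0.
  have : vpick {:E} != 0 by rewrite vpick0 -dimv_eq0; case: (\dim _) dimE.
  case/nondegP => v; exact: exists_anisotropic (memvf _) (memvf _).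
have proj x : bil (x - (bil x e / bil e e) *: e) e = 0.
  by rewrite linearBl /= linearZl_LR /= divfK ?subrr.
pose V := orthov bil <[e]>.
have VP x : (x \in V) = (bil x e == 0) by rewrite mem_orthov1.
have dimV : (0 < \dim V)%N.
  have := leq_dim_orthov1 bil e fullv; rewrite capfv -/V.
  by apply: leq_trans; case: (\dim _) dimE => [|[]].
have V0 : vpick V != 0 by rewrite vpick0 -dimv_eq0 -lt0n.
have [v uv] := nondegP _ V0.
have uV : vpick V \in V := memv_pick V.
(* The vector picked in V is orthogonal to e, so projecting v into V does not change their product:
   the form is nonzero on V. *)
pose w := v - (bil v e / bil e e) *: e.
have wV : w \in V by rewrite VP proj.
have uw : bil (vpick V) w != 0.
  rewrite linearBr /= linearZr_LR /=; move: uV; rewrite VP => /eqP ->.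
  by rewrite mulr0 subr0.
have [f fV ff] := exists_anisotropic uV wV uw.
by exists e, f; split=> //; rewrite bilC; apply/eqP; rewrite -VP.
Qed.

End OrthogonalPair.

(** * Soundness of the certificate *)

Section IntPolynomials.
Variables (F : fieldType) (d : F).

Definition zr (z : Z) : F := (int_of_Z z)%:~R.

Lemma zrD a b : zr (Z.add a b) = zr a + zr b.
Proof. by rewrite /zr -rmorphD -(rmorphD int_of_Z). Qed.

Lemma zrM a b : zr (Z.mul a b) = zr a * zr b.
Proof. by rewrite /zr -rmorphM -(rmorphM int_of_Z). Qed.

Lemma zrN a : zr (Z.opp a) = - zr a.
Proof. by rewrite /zr -rmorphN -(rmorphN int_of_Z). Qed.

Lemma zr_eq0 z : [pchar F] =i pred0 -> zr z = 0 -> z = Z0.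
Proof.
move=> charF0; have natr0 n : n%:R = 0 :> F -> n = 0%N.
  by move/eqP; rewrite natr_eq0F // => /eqP.
rewrite /zr => zr0; apply: (can_inj int_of_ZK); rewrite /=; move: zr0.
case: (int_of_Z z) => n; first by move/natr0->.
by rewrite NegzE mulrNz => /eqP; rewrite oppr_eq0 => /eqP/natr0.
Qed.

Definition peval (p : pol) : F := foldr (fun a x => zr a + d * x) 0 p.

Lemma peval_padd p q : peval (padd p q) = peval p + peval q.
Proof.
elim: p q => [|a p IHp] [|b q] /=; rewrite ?add0r ?addr0 //.
by rewrite IHp zrD; ring.
Qed.

Lemma peval_pscale c p : peval (pscale c p) = zr c * peval p.
Proof. by elim: p => [|a p /= ->]; rewrite ?mulr0 //= zrM; ring. Qed.

Lemma peval_pmul p q : peval (pmul p q) = peval p * peval q.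
Proof.
elim: p => [|a p IHp]; first by rewrite mul0r.
by rewrite [LHS]/= peval_padd peval_pscale /= IHp /zr /=; ring.
Qed.

Lemma peval_eq0 p : all (Z.eqb Z0) p -> peval p = 0.
Proof.
elim: p => //= a p IHp /andP[a0 /IHp->].
have -> : a = Z0 by apply/esym/Z.eqb_eq.
by rewrite mulr0 addr0.
Qed.

Lemma peval_foldr (T : Type) (g : T -> pol) s :
  peval (foldr (fun x p => padd (g x) p) [::] s) = \sum_(x <- s) peval (g x).
Proof.
elim: s => [|x s IHs]; first by rewrite big_nil.
by rewrite big_cons /= peval_padd IHs.
Qed.

End IntPolynomials.

Lemma peval_denom_neq0 (F : fieldType) (d : F) : [pchar F] =i pred0 ->
  d != 0 -> d + 2 != 0 -> 1 - 4 * d != 0 -> peval d denom != 0.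
Proof.
move=> charF0 d0 d2 d4.
have zr1 : zr F 1 = 1 by [].
have zr0 : zr F 0 = 0 by [].
have zrneq z : z <> Z0 -> zr F z != 0 by move=> z0; apply/eqP => /(zr_eq0 charF0).
have peval2 a b : peval d [:: a; b] = zr F a + zr F b * d.
  by rewrite /= mulr0 addr0 mulrC.
have -> : denom = factored_denom by [].
rewrite /factored_denom peval_pscale mulf_neq0 ?zrneq //.
rewrite 2!peval_pmul !iterS 4!peval_pmul !peval2 zr0 zr1 !mul1r add0r.
rewrite /= mulr0 !addr0 zr1 mulr1.
have -> : zr F 2 = 2 by [].
have -> : zr F (-4) = - 4 by [].
by rewrite mulNr !mulf_neq0 // addrC.
Qed.

(** * Monomials modulo commutativity, and their corrections *)

Lemma eqc_refl : reflexive eqc.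
Proof. by elim=> [i|u IHu v IHv] /=; rewrite ?eqxx // IHu IHv. Qed.

Lemma eqc_sym : symmetric eqc.
Proof.
elim=> [i|u IHu v IHv] [j|u1 v1] //=.
by rewrite !IHu !IHv [eqc v1 u && _]andbC.
Qed.

Lemma eqc_trans : transitive eqc.
Proof.
move=> t s r; elim: t s r => [i|u IHu v IHv] [j|u1 v1] [k|u2 v2] //=.
  by move=> /eqP-> /eqP->.
case/orP=> /andP[h1 h2]; case/orP=> /andP[h3 h4]; apply/orP.
- by left; rewrite (IHu _ _ h1 h3) (IHv _ _ h2 h4).
- by right; rewrite (IHu _ _ h1 h3) (IHv _ _ h2 h4).
- by right; rewrite (IHv _ _ h1 h4) (IHu _ _ h2 h3).
- by left; rewrite (IHv _ _ h1 h4) (IHu _ _ h2 h3).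
Qed.

Lemma eqc_leaves t u : eqc t u -> perm_eq (leaves t) (leaves u).
Proof.
elim: t u => [i|t1 IH1 t2 IH2] [j|u1 u2] //=; first by move/eqP->.
case/orP=> /andP[/IH1 p1 /IH2 p2]; first exact: perm_cat.
by rewrite perm_sym perm_catC perm_sym perm_cat.
Qed.

Lemma eqc_size t u : eqc t u -> magma_size t = magma_size u.
Proof. by move/eqc_leaves/perm_size; rewrite !size_leaves. Qed.

Lemma orient_eqc t : eqc t (orient t).
Proof.
elim: t => [i|u IHu v IHv] /=; first exact: eqxx.
by case: ifP => _ /=; rewrite IHu IHv ?orbT.
Qed.

Lemma orient_oriented t : oriented (orient t).
Proof.
elim: t => [i|u IHu v IHv] //=.
have [su sv] := (eqc_size (orient_eqc u), eqc_size (orient_eqc v)).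
case: leqP => [le_vu|lt_uv] /=; rewrite IHu IHv -su -sv ?le_vu //.
by rewrite ltnW.
Qed.

Lemma magma_size_relabel g t : magma_size (relabel g t) = magma_size t.
Proof. by rewrite -!size_leaves leaves_relabel size_map. Qed.

Lemma oriented_relabel g t : oriented (relabel g t) = oriented t.
Proof. by elim: t => //= u -> v ->; rewrite !magma_size_relabel. Qed.

(** Injectivity is required on [D] only: the relabelling used later sends x to its index in a leaf
    word, and is injective just on the letters of that word. *)
Lemma eqc_relabel (D : pred nat) g t u :
  {in D &, injective g} -> all D (leaves t) -> all D (leaves u) ->
  eqc (relabel g t) (relabel g u) = eqc t u.
Proof.
move=> g_inj; elim: t u => [i|t1 IH1 t2 IH2] [j|u1 u2] //=.
  by rewrite !andbT => Di Dj; apply/eqP/eqP => [/g_inj->//|->].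
rewrite !all_cat => /andP[? ?] /andP[? ?].
by rewrite !IH1 ?IH2.
Qed.

Lemma trees_ofP n t : (magma_size t <= n)%N -> t \in trees_of n (leaves t).
Proof.
elim: n t => [|n IHn] [i|u v] /=; rewrite ?inE ?eqxx //.
  by rewrite leqNgt (leq_trans (magma_size_gt0 u)) ?leq_addr.
have [su sv] := (magma_size_gt0 u, magma_size_gt0 v).
move=> le_n.
pose w := leaves u ++ leaves v.
suff : Prod u v \in flatten [seq [seq Prod a b | a <- trees_of n (take k w),
    b <- trees_of n (drop k w)] | k <- iota 1 (size w).-1].
  rewrite -/w; have : (1 < size w)%N by rewrite size_cat !size_leaves; lia.
  by case: (w) => [|i [|j l]].
apply/flattenP.
exists [seq Prod a b | a <- trees_of n (leaves u), b <- trees_of n (leaves v)].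
  apply/mapP; exists (magma_size u); last first.
    by rewrite -(size_leaves u) take_size_cat // drop_size_cat.
  by rewrite mem_iota size_cat !size_leaves; lia.
by apply/allpairsP; exists (u, v); split=> //=; apply: IHn; lia.
Qed.

Lemma oriented_treesP n t : oriented t -> magma_size t = n ->
  t \in oriented_trees n (leaves t).
Proof. by move=> ot <-; rewrite mem_filter ot trees_ofP. Qed.

Lemma pairwise_reps s :
  pairwise (fun t u => ~~ eqc t u) (foldr add_rep [::] s).
Proof.
elim: s => //= t s IHs; rewrite /add_rep; case: ifPn => //= nt.
rewrite IHs andbT; apply/allP => u us; apply: contra nt => tu.
by apply/hasP; exists u.
Qed.

Lemma has_reps s t : t \in s -> has (eqc t) (foldr add_rep [::] s).
Proof.
elim: s => //= u s IHs; rewrite inE /add_rep => /predU1P[->|/IHs ht].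
  by case: ifPn => //= _; rewrite eqc_refl.
by case: ifPn => //= _; rewrite ht orbT.
Qed.

Lemma sub_reps s t : t \in foldr add_rep [::] s -> t \in s.
Proof.
elim: s => //= u s IHs; rewrite /add_rep; case: ifPn => _.
  by move/IHs; rewrite inE orbC => ->.
by rewrite !inE => /predU1P[->|/IHs->]; rewrite ?eqxx ?orbT.
Qed.

Lemma leaves_trees_of n l t : t \in trees_of n l -> leaves t = l.
Proof.
elim: n l t => [|n IHn] l t //=.
case: l => [|i [|j l]]; rewrite ?inE; [by [] | by move/eqP-> |].
case/flattenP=> ts /mapP[k _ ->] /allpairsP[[u v] /= [/IHn lu /IHn lv ->]] /=.
by rewrite lu lv cat_take_drop.
Qed.

Lemma multilinear_size n t : multilinear n t -> magma_size t = n.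
Proof. by move/perm_size; rewrite size_leaves size_iota. Qed.

Lemma reps_multilinear n t : t \in reps n -> multilinear n t /\ oriented t.
Proof.
move/sub_reps/flattenP=> [ts /mapP[l pl ->]]; rewrite mem_filter => /andP[-> /leaves_trees_of Dl].
by split=> //; rewrite /multilinear Dl -mem_permutations.
Qed.

Lemma has_reps_multilinear n t : multilinear n t -> oriented t -> has (eqc t) (reps n).
Proof.
move=> tn ot; apply: has_reps; apply/flattenP; exists (oriented_trees n (leaves t)).
  by apply: map_f; rewrite mem_permutations.
by rewrite oriented_treesP ?(multilinear_size tn).
Qed.

Lemma sum_rep (V : nmodType) (g : magma -> V) s t :
  pairwise (fun t u => ~~ eqc t u) s -> has (eqc t) s ->
  exists u, [/\ u \in s, eqc t u & \sum_(v <- s | eqc t v) g v = g u].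
Proof.
elim: s => //= u s IHs /andP[/allP nu ps]; rewrite big_cons.
case: ifP => [tu _|_ /= /(IHs ps)[v [vs tv ->]]].
  exists u; split=> //; first exact: mem_head.
  rewrite big_seq_cond big_pred0 ?addr0 // => v; apply/andP => -[/nu nuv tv].
  by move: nuv; rewrite (eqc_trans _ tv) // eqc_sym.
by exists v; rewrite inE vs orbT.
Qed.

Lemma coef_cat t s1 s2 : coef t (s1 ++ s2) = Z.add (coef t s1) (coef t s2).
Proof.
elim: s1 => [|p s1 IHs] //=; rewrite IHs; case: ifP => // _.
by rewrite BinInt.Z.add_assoc.
Qed.

Lemma coef_opp t s : coef t [seq (Z.opp p.1, p.2) | p <- s] = Z.opp (coef t s).
Proof.
elim: s => [|p s IHs] //=; rewrite IHs; case: ifP => // _.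
by rewrite BinInt.Z.opp_add_distr.
Qed.

Lemma coef_relabel (D : pred nat) g t s :
  {in D &, injective g} -> all D (leaves t) ->
  all (fun p => all D (leaves p.2)) s ->
  coef (relabel g t) [seq (p.1, relabel g p.2) | p <- s] = coef t s.
Proof.
move=> g_inj Dt; elim: s => //= p s IHs /andP[Dp /IHs ->].
by rewrite (eqc_relabel g_inj).
Qed.

(** The correction is natural in the variables, which is what lets one row per shape serve all
    monomials of that shape. *)
Lemma nform_relabel g t :
  nform (relabel g t) = [seq (p.1, relabel g p.2) | p <- nform t].
Proof.
rewrite /nform /=; congr (_ :: _); rewrite -map_comp.
by case: t => [?|[?|[?|[?|[?|? ?] [?|? ?]] [?|? ?]] [?|? ?]] [?|? ?]].
Qed.

Lemma leaves_lin5 a b b' c d l : perm_eq [:: a; b; b'; c; d] l ->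
  all (fun p => perm_eq (leaves p.2) l)
    (lin5 (Gen a) (Gen b) (Gen b') (Gen c) (Gen d)).
Proof.
move=> pl; have assoc2P x y z w v : perm_eq [:: x; y; z; w; v] [:: a; b; b'; c; d] ->
    all (fun p => perm_eq (leaves p.2) l) (assoc2 (Gen x) (Gen y) (Gen z) (Gen w) (Gen v)).
  by move=> /perm_trans/(_ pl) xl; rewrite /assoc2 /all !xl.
by rewrite /lin5 /id5 !all_cat !assoc2P //; apply/permP => i /=; lia.
Qed.

Definition caterpillar x y z u v :=
  Prod (Prod (Prod (Prod (Gen x) (Gen y)) (Gen z)) (Gen u)) (Gen v).

Variant caterpillar_spec t : Prop :=
  | Caterpillar x y z u v of t = caterpillar x y z u v
  | NotCaterpillar of correction t = [::].

Lemma caterpillarP t : caterpillar_spec t.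
Proof.
case: t => [?|[?|[?|[?|[x|? ?] [y|? ?]] [z|? ?]] [u|? ?]] [v|? ?]];
  by [exact: NotCaterpillar | exact: (@Caterpillar _ x y z u v)].
Qed.

Lemma correction_multilinear t n : multilinear n t ->
  all (fun p => multilinear n p.2) (correction t).
Proof.
case: (caterpillarP t) => [x y z u v -> tn|-> //].
have allcat (a : pred (Z * magma)) s1 s2 : all a s1 -> all a s2 -> all a (s1 ++ s2).
  by rewrite all_cat => -> ->.
by do 2!apply: (@allcat _); apply: leaves_lin5; apply: perm_trans tn;
  apply/permP => i /=; lia.
Qed.

Lemma eqc_Prod_Gen u v t : (1 < magma_size u)%N -> oriented t ->
  eqc (Prod u (Gen v)) t ->
  exists u', [/\ t = Prod u' (Gen v), eqc u u' & oriented u'].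
Proof.
move=> u1; case: t => [//|t1 t2] /and3P[le_t o1 o2] /=.
case/orP=> /andP[h1 h2].
  by case: t2 h2 {le_t o2} => // j /eqP<-; exists t1.
case: t1 h2 le_t {o1} => // j _; rewrite -(eqc_size h1) /=.
by rewrite leqNgt u1.
Qed.

(** Orientation fixes every product except the innermost one, whose two factors have the same
    size. *)
Lemma eqc_caterpillar x y z u v t : oriented t ->
  eqc (caterpillar x y z u v) t ->
  t = caterpillar x y z u v \/ t = caterpillar y x z u v.
Proof.
move=> ot; case/eqc_Prod_Gen=> // t1 [-> + o1].
case/eqc_Prod_Gen=> // t2 [-> + o2]; case/eqc_Prod_Gen=> // t3 [-> + _].
case: t3 => [//|[i|? ?] [j|? ?]] /=; rewrite ?andbF //.
by case/orP=> /andP[/eqP-> /eqP->]; [left|right].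
Qed.

(** The terms come in pairs exchanged by x <-> y; this makes the correction of oriented monomials
    compatible with commutativity. *)
Lemma correction_caterpillarC T x y z u v :
  coef T (correction (caterpillar x y z u v))
  = coef T (correction (caterpillar y x z u v)).
Proof.
by rewrite /correction /caterpillar !coef_cat; congr (Z.add _ _); rewrite BinInt.Z.add_comm.
Qed.

Lemma coef_correction_eqc T t t' : oriented t -> oriented t' -> eqc t t' ->
  coef T (correction t) = coef T (correction t').
Proof.
case: (caterpillarP t) => [x y z u v -> _ ot'|ct].
  by case/eqc_caterpillar=> // -> //; exact: correction_caterpillarC.
case: (caterpillarP t') => [x y z u v -> ot _|ct' _ _ _]; last by rewrite ct ct'.
rewrite eqc_sym => /eqc_caterpillar-/(_ ot)[] ->; last exact: correction_caterpillarC.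
by [].
Qed.

Lemma coef_nform_eqc T t t' : oriented t -> oriented t' -> eqc t t' ->
  coef T (nform t) = coef T (nform t').
Proof.
move=> ot ot' tt'; rewrite /nform /= !coef_opp (coef_correction_eqc T ot ot' tt').
suff -> : eqc t T = eqc t' T by [].
by apply/idP/idP; apply: eqc_trans; rewrite // eqc_sym.
Qed.

Lemma nform_multilinear n t : multilinear n t -> all (fun p => multilinear n p.2) (nform t).
Proof.
by move=> tn; rewrite /nform /= tn all_map; exact: correction_multilinear.
Qed.

(** * Congruences modulo a T-ideal containing both identities *)

Section Congruence.
Variables (F : fieldType) (I : free_alg F -> Prop).
Hypothesis I_Tideal : is_Tideal I.
Hypothesis I_comm : I (commutativity F).
Hypothesis I_deg5 : I (degree5_identity F).
Implicit Types (f g h : free_alg F) (t u v : magma).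

Lemma Tideal_trans f g h : I (f - g) -> I (g - h) -> I (f - h).
Proof.
by move=> /(TidealD I_Tideal) IfgD /IfgD; rewrite addrA subrK.
Qed.

Lemma Tideal_mul f f' g g' :
  I (f - f') -> I (g - g') -> I (fmul f g - fmul f' g').
Proof.
move=> If Ig; apply: (@Tideal_trans _ (fmul f' g)).
  by rewrite -fmulBl; exact: TidealMr.
by rewrite -fmulBr; exact: TidealMl.
Qed.

Lemma Tideal_comm f g : I (fmul f g - fmul g f).
Proof.
have := Tideal_subst I_Tideal (fun i => if i == 0%N then f else g) I_comm.
by rewrite /commutativity linearB /= !fsubstM !fsubst_gen.
Qed.

Lemma Tideal_eqc t u : eqc t u -> I (mon F t - mon F u).
Proof.
elim: t u => [i|t1 IH1 t2 IH2] [j|u1 u2] //=.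
  by move/eqP->; rewrite subrr; exact: Tideal0.
rewrite -!fmulUU; case/orP=> /andP[/IH1 I1 /IH2 I2]; first exact: Tideal_mul.
by apply: (Tideal_trans _ (Tideal_comm _ _)); exact: Tideal_mul.
Qed.

Definition linZ (s : seq (Z * magma)) : free_alg F :=
  \sum_(p <- s) zr F p.1 *: mon F p.2.

Lemma linZ_cat s1 s2 : linZ (s1 ++ s2) = linZ s1 + linZ s2.
Proof. exact: big_cat. Qed.

(** The two occurrences of b are made independent, as f1 and f1'. *)
Definition polar_identity f0 f1 f1' f2 f3 : free_alg F :=
  fassoc (fassoc f0 f1 f2) f3 f1' + fassoc (fassoc f2 f1 f3) f0 f1'
  + fassoc (fassoc f3 f1 f0) f2 f1'.

Lemma fassocDl f f' g h : fassoc (f + f') g h = fassoc f g h + fassoc f' g h.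
Proof. by rewrite /fassoc !fmulDl opprD addrACA. Qed.

Lemma fassocDm f g g' h : fassoc f (g + g') h = fassoc f g h + fassoc f g' h.
Proof. by rewrite /fassoc fmulDr !fmulDl fmulDr opprD addrACA. Qed.

Lemma fassocDr f g h h' : fassoc f g (h + h') = fassoc f g h + fassoc f g h'.
Proof. by rewrite /fassoc !fmulDr opprD addrACA. Qed.

Lemma polar_identityDl f0 f1 g1 f1' f2 f3 :
  polar_identity f0 (f1 + g1) f1' f2 f3 =
  polar_identity f0 f1 f1' f2 f3 + polar_identity f0 g1 f1' f2 f3.
Proof.
rewrite /polar_identity; move: (@fassoc F) fassocDl fassocDm => T TDl TDm.
by rewrite !TDm !TDl [RHS]addrACA; congr (_ + _); exact: addrACA.
Qed.

Lemma polar_identityDr f0 f1 f1' g1' f2 f3 :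
  polar_identity f0 f1 (f1' + g1') f2 f3 =
  polar_identity f0 f1 f1' f2 f3 + polar_identity f0 f1 g1' f2 f3.
Proof.
rewrite /polar_identity; move: (@fassoc F) fassocDr => T TDr.
by rewrite !TDr [RHS]addrACA; congr (_ + _); exact: addrACA.
Qed.

Lemma fsubst_assoc s f g h :
  fsubst s (fassoc f g h) = fassoc (fsubst s f) (fsubst s g) (fsubst s h).
Proof. by rewrite /fassoc linearB /= !fsubstM. Qed.

Lemma Tideal_polar_diag f0 f1 f2 f3 : I (polar_identity f0 f1 f1 f2 f3).
Proof.
pose s := nth 0 [:: f0; f1; f2; f3].
have := Tideal_subst I_Tideal s I_deg5.
rewrite /degree5_identity /polar_identity /=.
move: (@fassoc F) (fsubst_assoc s) => T TE.
by rewrite !linearD /= !TE !fsubst_gen.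
Qed.

(** Putting b = f1 + f1' and removing the values at b = f1 and b = f1' leaves the two mixed
    terms. *)
Lemma Tideal_polar f0 f1 f1' f2 f3 :
  I (polar_identity f0 f1 f1' f2 f3 + polar_identity f0 f1' f1 f2 f3).
Proof.
have := Tideal_polar_diag f0 (f1 + f1') f2 f3.
have := Tideal_polar_diag f0 f1 f2 f3; have := Tideal_polar_diag f0 f1' f2 f3.
rewrite polar_identityDl !polar_identityDr.
move: (polar_identity f0 f1 f1 f2 f3) (polar_identity f0 f1' f1' f2 f3).
move: (polar_identity f0 f1 f1' f2 f3) (polar_identity f0 f1' f1 f2 f3).
move=> c d a b Ib Ia Isum.
have cancel (V : zmodType) (x y z t : V) : x + z + (t + y) - x - y = z + t.
  by rewrite addrAC addrA addrK addrAC [x + z]addrC addrK.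
rewrite -(cancel _ a b c d : _ = c + d).
exact: (TidealB I_Tideal (TidealB I_Tideal Isum Ia) Ib).
Qed.

Lemma linZ_assoc2 a b c d e : linZ (assoc2 a b c d e) =
  fassoc (fassoc (mon F a) (mon F b) (mon F c)) (mon F d) (mon F e).
Proof.
have zr1 : zr F 1 = 1 by []. have zrN1 : zr F (-1) = -1 by [].
rewrite /linZ !big_cons big_nil /= zr1 zrN1 !scaleN1r !scale1r addr0.
rewrite /fassoc !fmulUU !fmulBl !fmulUU opprB -addrA; congr (_ + (_ + _)).
exact: addrC.
Qed.

Lemma linZ_id5 a b b' c d : linZ (id5 a b b' c d) =
  polar_identity (mon F a) (mon F b) (mon F b') (mon F c) (mon F d).
Proof.
rewrite /id5 linZ_cat (linZ_cat (assoc2 _ _ _ _ _) (assoc2 _ _ _ _ _)).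
by rewrite !linZ_assoc2 addrA.
Qed.

Lemma Tideal_lin5 a b b' c d : I (linZ (lin5 a b b' c d)).
Proof. by rewrite /lin5 linZ_cat !linZ_id5; exact: Tideal_polar. Qed.

Lemma Tideal_correction t : I (linZ (correction t)).
Proof.
case: (caterpillarP t) => [x y z u v ->|->]; last by rewrite /linZ big_nil; exact: Tideal0.
rewrite /correction /caterpillar.
have IC s1 s2 : I (linZ s1) -> I (linZ s2) -> I (linZ (s1 ++ s2)).
  by rewrite linZ_cat; exact: TidealD.
by do 2!apply: (@IC _); exact: Tideal_lin5.
Qed.

Lemma Tideal_nform t : I (linZ (nform t) - (12 : F) *: mon F t).
Proof.
have zr12 : zr F 12 = 12 by [].
rewrite /linZ /nform big_cons /= zr12 addrC addrA addNr add0r big_map /=.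
under eq_bigr do rewrite zrN scaleNr.
by rewrite sumrN; apply: TidealN => //; exact: Tideal_correction.
Qed.

Lemma Tideal_sumB (J : Type) (r : seq J) (g h : J -> free_alg F) :
  (forall j, I (g j - h j)) -> I (\sum_(j <- r) g j - \sum_(j <- r) h j).
Proof.
move=> Igh; elim: r => [|j r IHr]; first by rewrite !big_nil subrr; exact: Tideal0.
by rewrite !big_cons opprD addrACA; exact: TidealD.
Qed.

Lemma zr_coef t s : zr F (coef t s) = \sum_(p <- s | eqc p.2 t) zr F p.1.
Proof.
elim: s => [|p s IHs]; first by rewrite big_nil.
by rewrite big_cons /= -IHs; case: ifP => // _; rewrite zrD.
Qed.

(** Each monomial is congruent to its unique representative in [reps n], found through its
    orientation; collecting the terms gives the coefficients [coef]. *)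
Lemma Tideal_linZ n s : all (fun p => multilinear n p.2) s ->
  I (linZ s - \sum_(t <- reps n) zr F (coef t s) *: mon F t).
Proof.
move=> /allP sn.
have -> : \sum_(t <- reps n) zr F (coef t s) *: mon F t =
    \sum_(p <- s) zr F p.1 *: (\sum_(t <- reps n | eqc p.2 t) mon F t).
  under eq_bigr do rewrite zr_coef scaler_suml big_mkcond.
  under [RHS]eq_bigr do rewrite scaler_sumr big_mkcond.
  exact: exchange_big.
rewrite /linZ -sumrB; apply: Tideal_sum => // p /sn pn _.
rewrite -scalerBr; apply: TidealZ => //.
have [|u [_ pu ->]] := @sum_rep _ (mon F) (reps n) p.2 (pairwise_reps _).
  have /hasP[u un pu] : has (eqc (orient p.2)) (reps n).
    apply: has_reps_multilinear (orient_oriented _).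
    by rewrite /multilinear -(permPl (eqc_leaves (orient_eqc _))).
  by apply/hasP; exists u => //; apply: eqc_trans pu; exact: orient_eqc.
exact: Tideal_eqc.
Qed.

Variable alpha : F.
Hypothesis charF0 : [pchar F] =i pred0.
Local Notation delta := (alpha * (1 - alpha)).
Hypotheses (delta0 : delta != 0) (delta2 : delta + 2 != 0)
  (delta4 : 1 - 4 * delta != 0).

Definition geval (x : (bool * bool) * (pol * pol)) : (bool * bool) * (F * F) :=
  (x.1, (peval delta x.2.1, peval delta x.2.2)).

(** Evaluation at delta is a ring homomorphism from Z[d], so it carries the generic multiplication
    table to the one over [F]. *)
Lemma geval_pgmul x y : geval (pgmul x y) = gmulF alpha (geval x) (geval y).
Proof.
have zr1 : zr F 1 = 1 by []. have zr0 : zr F 0 = 0 by [].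
have zrN1 : zr F (-1) = -1 by []. have zrN2 : zr F (-2) = -2 by [].
case: x => [[i j] [x0 x1]]; case: y => [[k l] [y0 y1]].
have peval0 : peval delta [::] = 0 by [].
have peval_cons a p : peval delta (a :: p) = zr F a + delta * peval delta p by [].
rewrite /geval /pgmul /gmulF /=; congr pair.
case: i; case: j; case: k; case: l => //; congr pair;
  by rewrite ?(peval_padd, peval_pmul, peval_pscale, peval0, peval_cons)
     ?(zr0, zr1, zrN1, zrN2) //; ring.
Qed.

Lemma geval_pval b t : geval (pval b t) = gvalF alpha b t.
Proof.
elim: t => [i|u IHu v IHv].
  rewrite /geval /pval /gvalF /gval /=; case: (b i) => [|[|[|k]]] /=;
    by rewrite ?mulr0 ?addr0.
by rewrite gvalF_Prod -IHu -IHv -geval_pgmul.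
Qed.

Lemma gvalF_eqc b t u : eqc t u -> gvalF alpha b t = gvalF alpha b u.
Proof.
elim: t u => [i|t1 IH1 t2 IH2] [j|u1 u2] //=; first by move/eqP->.
rewrite !gvalF_Prod; case/orP=> /andP[/IH1-> /IH2->] //.
exact: gmulF_comm.
Qed.

Lemma gvalF_relabel b (g : nat -> nat) t : gvalF alpha b (relabel g t) = gvalF alpha (b \o g) t.
Proof. by elim: t => // u IHu v IHv; rewrite /= !gvalF_Prod IHu IHv. Qed.

Lemma peval_cert_sum t t' : peval delta (cert_sum t t') =
  \sum_(r <- rows_of t) peval delta r.2 *
    \sum_(l <- twists t) gcoord r.1.2 (gvalF alpha (word r.1.1 l) t').
Proof.
rewrite /cert_sum peval_foldr; apply: eq_bigr => r _.
rewrite peval_pmul peval_foldr; congr (_ * _); apply: eq_bigr => l _.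
by rewrite -geval_pval; case: r.1.2.
Qed.

(** The check ran over representatives only; both sides are unchanged when t' is replaced by the
    representative of its class. *)
Lemma certificate n t t' : (0 < n <= 5)%N ->
  t \in oriented_trees n (iota 0 n) -> oriented t' -> multilinear n t' ->
  peval delta denom * zr F (coef t (nform t')) =
  \sum_(r <- rows_of t) peval delta r.2 *
    \sum_(l <- twists t) gcoord r.1.2 (gvalF alpha (word r.1.1 l) t').
Proof.
move=> /cert_okP/allP n_ok tn ot' t'n; have /hasP[u un t'u] := has_reps_multilinear t'n ot'.
have [_ ou] := reps_multilinear un.
rewrite (coef_nform_eqc t ot' ou t'u).
have -> : \sum_(r <- rows_of t) peval delta r.2 *
      \sum_(l <- twists t) gcoord r.1.2 (gvalF alpha (word r.1.1 l) t') =
    peval delta (cert_sum t u).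
  rewrite peval_cert_sum; apply: eq_bigr => r _; congr (_ * _).
  by apply: eq_bigr => l _; rewrite (gvalF_eqc _ t'u).
have /allP/(_ u un)/(peval_eq0 delta) := n_ok t tn.
rewrite peval_padd peval_pscale zrN mulNr addrC => /eqP.
by rewrite subr_eq0 => /eqP ->; rewrite mulrC.
Qed.

Theorem Tideal_multilinear n (P : seq (F * magma)) : (0 < n <= 5)%N ->
  all (multilinear n) (map snd P) ->
  (forall b k, \sum_(p <- P) p.1 * gcoord k (gvalF alpha b p.2) = 0) ->
  I (\sum_(p <- P) p.1 *: mon F p.2).
Proof.
move=> n_bnd /allP Pn P0.
have multilinearP p : p \in P -> multilinear n p.2 by move=> pP; apply/Pn/map_f.
have multilinear_orient t : multilinear n t -> multilinear n (orient t).
  by rewrite /multilinear -(permPl (eqc_leaves (orient_eqc t))).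
have coef0 t : t \in reps n ->
    \sum_(p <- P) p.1 * zr F (coef t (nform (orient p.2))) = 0.
  case/reps_multilinear=> tn ot; pose g x := index x (leaves t).
  have ut : uniq (leaves t) by rewrite (perm_uniq tn) iota_uniq.
  have g_inj : {in mem (leaves t) &, injective g}.
    by move=> x y xt yt /(congr1 (nth 0%N (leaves t))); rewrite !nth_index.
  have inD u : multilinear n u -> all (mem (leaves t)) (leaves u).
    by move=> un; apply/allP => x /=; rewrite (perm_mem un) (perm_mem tn).
  have relabel_t : leaves (relabel g t) = iota 0 n.
    rewrite leaves_relabel; apply: (@eq_from_nth _ 0%N).
      by rewrite size_map size_leaves size_iota (multilinear_size tn).
    rewrite size_map => i lti; rewrite (nth_map 0%N) // /g index_uniq // nth_iota //.
    by rewrite -(multilinear_size tn) -size_leaves.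
  have multilinear_relabel u : multilinear n u -> multilinear n (relabel g u).
    move=> un; rewrite /multilinear -relabel_t !leaves_relabel perm_map //.
    by rewrite (permPl un) perm_sym.
  apply: (mulfI (peval_denom_neq0 charF0 delta0 delta2 delta4)).
  rewrite mulr0 mulr_sumr.
  have tS : relabel g t \in oriented_trees n (iota 0 n).
    rewrite -relabel_t oriented_treesP ?oriented_relabel //.
    by rewrite magma_size_relabel (multilinear_size tn).
  transitivity (\sum_(r <- rows_of (relabel g t)) peval delta r.2 *
      \sum_(l <- twists (relabel g t)) \sum_(p <- P)
        p.1 * gcoord r.1.2 (gvalF alpha (word r.1.1 l \o g) p.2)).
    rewrite [RHS](eq_bigr (fun r => \sum_(p <- P) p.1 * (peval delta r.2 *
        \sum_(l <- twists (relabel g t))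
          gcoord r.1.2 (gvalF alpha (word r.1.1 l \o g) p.2)))); last first.
      move=> r _; rewrite exchange_big mulr_sumr; apply: eq_bigr => p _ /=.
      by rewrite mulrCA; congr (_ * _); rewrite mulr_sumr.
    rewrite exchange_big !big_seq; apply: eq_bigr => p /multilinearP pn.
    rewrite mulrCA -mulr_sumr; congr (_ * _).
    have on := multilinear_orient _ pn.
    rewrite -(coef_relabel g_inj (inD _ tn)) -?nform_relabel; last first.
      apply: sub_all (nform_multilinear on) => q; exact: inD.
    rewrite (certificate n_bnd tS); last 2 first.
    - by rewrite oriented_relabel orient_oriented.
    - exact: multilinear_relabel.
    apply: eq_bigr => r _; congr (_ * _); apply: eq_bigr => l _.
    by rewrite gvalF_relabel -(gvalF_eqc _ (orient_eqc _)).
  rewrite big1 // => r _; rewrite big1 ?mulr0 // => l _; exact: P0.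
have F12 : (12 : F) != 0 by rewrite natr_eq0F.
rewrite -[X in I X](scalerK F12) scaler_sumr; apply: TidealZ => //.
have step1 : I (\sum_(p <- P) 12 *: (p.1 *: mon F p.2)
                - \sum_(p <- P) p.1 *: linZ (nform (orient p.2))).
  apply: Tideal_sumB => p; rewrite scalerA mulrC -scalerA -scalerBr.
  apply: TidealZ => //; rewrite -opprB; apply: TidealN => //.
  apply: (Tideal_trans (Tideal_nform _)).
  rewrite -scalerBr; apply: TidealZ => //; rewrite -opprB; apply: TidealN => //.
  exact/Tideal_eqc/orient_eqc.
have step2 : I (\sum_(p <- P) p.1 *: linZ (nform (orient p.2)) -
    \sum_(p <- P) p.1 *: \sum_(t <- reps n) zr F (coef t (nform (orient p.2))) *: mon F t).
  rewrite -sumrB; apply: Tideal_sum => // p /multilinearP pn _.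
  rewrite -scalerBr; apply: TidealZ => //; apply: Tideal_linZ.
  exact/nform_multilinear/multilinear_orient.
have := Tideal_trans step1 step2; rewrite [X in I (_ - X)](_ : _ = 0) ?subr0 //.
under eq_bigr do rewrite scaler_sumr.
rewrite exchange_big big_seq big1 // => t /coef0 t0 /=.
by under eq_bigr do rewrite scalerA; rewrite -scaler_suml t0 scale0r.
Qed.

End Congruence.

Theorem theorem4 (F : fieldType) (charF0 : [pchar F] =i pred0)
  (alpha : F) (alphaP : alpha \notin [:: -1; 0; 2^-1; 1; 2])
  (E : vectType F) (dimE : (2 <= \dim {:E})%N)
  (bil : {symmetric E}) (bil_nondeg : nondegenerate bil)
  (f : free_alg F) (deg_f : (fdegree f <= 5)%N)
  (f_id : is_identity (Smul alpha bil) f) :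
  is_consequence (fun g => g = commutativity F \/ g = degree5_identity F) f.
Proof.
move=> I I_Tideal IG.
have F2 : 2 != 0 :> F by rewrite natr_eq0F.
have [e [f0 [ef ee ff]]] := exists_orthogonal_pair F2 dimE bil_nondeg.
move: alphaP; rewrite !inE !negb_or => /and5P[aN1 a0 ah a1 a2].
have half : 2 * alpha != 1.
  by apply: contraNneq ah => h; rewrite -[alpha](mulKf F2) h mulr1.
apply: (Tideal_of_multilinear charF0 I_Tideal (Smul_linl alpha bil)
  (Smul_linr alpha bil) _ deg_f f_id) => n P n_bnd Pn P_id.
apply: (Tideal_multilinear I_Tideal _ _ charF0 (alpha := alpha) _ _ _ n_bnd Pn).
- by apply: IG; left.
- by apply: IG; right.
- by rewrite mulf_neq0 // subr_eq0 eq_sym.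
- have -> : alpha * (1 - alpha) + 2 = (2 - alpha) * (alpha + 1) by ring.
  by apply: mulf_neq0; [rewrite subr_eq0 eq_sym|rewrite addr_eq0].
- have -> : 1 - 4 * (alpha * (1 - alpha)) = (2 * alpha - 1) ^+ 2 by ring.
  by rewrite expf_neq0 // subr_eq0.
- move=> b k; exact: (gcoord_sum_eq0 ef ee ff half b k Pn P_id).
Qed.
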